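(* For every $k_0\ge 0$ there exists an admissible control $c^*\in\Lambda(k_0)$ which is optimal at $k_0$, i.e. $U(c^*;k_0)=V(k_0)=\sup_{c\in\Lambda(k_0)}U(c;k_0)$, which satisfies $c^*(t)\ge 0$ for every $t\ge 0$, and which is locally bounded: $c^*\in L^\infty_{loc}([0,+\infty),\mathbb{R})$.
   Context: Production function: $F:\mathbb{R}\to\mathbb{R}$ is $\mathcal{C}^1$ with $F'>0$ on $\mathbb{R}$, $F(0)=0$, $\lim_{x\to+\infty}F(x)=+\infty$, $L:=\lim_{x\to+\infty}F'(x)>0$; for some $0<\underline{k}<\overline{k}$, $F$ is concave on $[0,\underline{k}]$ and on $[\overline{k},+\infty)$ and convex on $[\underline{k},\overline{k}]$. Utility: $\rho>0$, and $u:[0,+\infty)\to\mathbb{R}$ is strictly increasing and strictly concave, continuous on $[0,+\infty)$ and $\mathcal{C}^2$ on $(0,+\infty)$, with $u(0)=0$, $\lim_{x\to+\infty}u(x)=+\infty$, $\lim_{x\to0^+}u'(x)=+\infty$, $\lim_{x\to+\infty}u'(x)=0$; $\epsilon_0>0$ is a fixed constant with $\lim_{t\to+\infty}e^{\epsilon_0 t}e^{-\rho t}u\left(e^{(L+\epsilon_0)t}\right)=0$. State equation: for $k_0\ge0$ and $c\in\mathcal{L}^1_{loc}([0,+\infty),\mathbb{R})$ (integrable on each bounded interval $[0,T]$), $k(\cdot;k_0,c)$ is the unique (locally absolutely continuous) solution of $k(0)=k_0$, $\dot k(t)=F(k(t))-c(t)$ for (a.e.) $t\ge0$. Admissible controls: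 $\Lambda(k_0)$ is the set of $c\in\mathcal{L}^1_{loc}([0,+\infty),\mathbb{R})$ such that $c\ge0$ almost everywhere and $k(\cdot;k_0,c)\ge0$ (i.e. the solution is defined and nonnegative on all of $[0,+\infty)$). Functional and value function: $U(c;k_0):=\int_0^{+\infty}e^{-\rho t}u(c(t))\,dt$ for $c\in\Lambda(k_0)$, and $V:[0,+\infty)\to\mathbb{R}$, $V(k_0):=\sup_{c\in\Lambda(k_0)}U(c;k_0)$. *)

(* Defs.v *)
From HB Require Import structures.
From mathcomp Require Import all_boot all_order all_algebra.
From mathcomp Require Import all_classical all_reals all_analysis.

Set Implicit Arguments.
Unset Strict Implicit.
Unset Printing Implicit Defensive.

Import Order.TTheory GRing.Theory Num.Theory.
Import numFieldNormedType.Exports.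

Local Open Scope classical_set_scope.
Local Open Scope ring_scope.

(* Utilities, controls and trajectories, which live on the half-line [0, +oo[,
   are represented by total functions R -> R; their values at negative
   arguments are irrelevant below. In particular u may be evaluated at a
   negative consumption only on a null set of times. *)

Section real_functions.
Context {R : realType}.
Implicit Types (D : set R) (f : R -> R).

Definition concave_on D f : Prop :=
  @convex_function R R^o D (fun x => - f x).

Definition convex_on D f : Prop := @convex_function R R^o D f.

Definition strictly_concave_on D f : Prop :=
  forall x y t : R, D x -> D y -> x != y -> 0 < t < 1 ->
    t * f x + (1 - t) * f y < f (t * x + (1 - t) * y).

Definition absolutely_continuous_on (a b : R) f : Prop :=
  forall e : R, 0 < e -> exists2 d : R, 0 < d &
    forall (n : nat) (I : 'I_n -> R * R),
      (forall i, [/\ a <= (I i).1, (I i).1 < (I i).2 & (I i).2 <= b]) ->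
      trivIset [set: 'I_n] (fun i => `](I i).1, (I i).2[%classic) ->
      \sum_(i < n) ((I i).2 - (I i).1) < d ->
      \sum_(i < n) `|f (I i).2 - f (I i).1| < e.

(* The measurable sets are the Borel sets. Every Lebesgue measurable function
   is a.e. equal to a Borel one, so the spaces of classes are the usual ones. *)
Definition L1_loc f : Prop :=
  forall T : R, 0 < T ->
    (@lebesgue_measure R).-integrable `[0, T] (EFin \o f).

Definition Linfty_loc f : Prop :=
  forall T : R, 0 < T ->
    measurable_fun `[0, T] f /\
    finite_norm (@lebesgue_measure R) +oo%E (f \_ `[0, T]).

End real_functions.

Section optimal_growth.
Context {R : realType}.
Implicit Types F u c k : R -> R.

Record production_function F (L klow kbar : R) : Prop := ProductionFunction {
  prod_derivable : forall x : R, derivable F x 1 ;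
  prod_derive_continuous : continuous (derive1 F) ;
  prod_derive_gt0 : forall x : R, 0 < derive1 F x ;
  prod_at0 : F 0 = 0 ;
  prod_cvg_pinfty : F x @[x --> +oo%R] --> +oo%R ;
  prod_derive_cvg : derive1 F x @[x --> +oo] --> L ;
  prod_limit_gt0 : 0 < L ;
  prod_klow_gt0 : 0 < klow ;
  prod_klow_lt_kbar : klow < kbar ;
  prod_concave_low : concave_on `[0, klow] F ;
  prod_convex_mid : convex_on `[klow, kbar] F ;
  prod_concave_high : concave_on `[kbar, +oo[ F
}.

Record utility_function u (rho L eps0 : R) : Prop := UtilityFunction {
  util_increasing : forall x y : R, 0 <= x -> x < y -> u x < u y ;
  util_strictly_concave : strictly_concave_on `[0, +oo[ u ;
  util_continuous : {within `[0, +oo[, continuous u} ;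
  util_derivable : forall x : R, 0 < x -> derivable u x 1 ;
  util_derivable2 : forall x : R, 0 < x -> derivable (derive1 u) x 1 ;
  util_derive2_continuous : forall x : R, 0 < x -> {for x, continuous (derive1n 2 u)} ;
  util_at0 : u 0 = 0 ;
  util_cvg_pinfty : u x @[x --> +oo%R] --> +oo%R ;
  util_derive_at0 : derive1 u x @[x --> 0^'+] --> +oo ;
  util_derive_at_pinfty : derive1 u x @[x --> +oo] --> (0 : R) ;
  util_discount :
    expR (eps0 * t) * expR (- rho * t) * u (expR ((L + eps0) * t))
      @[t --> +oo] --> (0 : R)
}.

Definition is_trajectory F (k0 : R) c k : Prop :=
  [/\ k 0 = k0,
      forall T : R, 0 < T -> absolutely_continuous_on 0 T k &
      {ae @lebesgue_measure R, forall t : R, 0 <= t ->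
        is_derive t 1 k (F (k t) - c t)}].

(* For F of class C^1 there is at most one trajectory on [0, +oo[, but it may
   fail to exist globally (F need not be Lipschitz on the negative half-line);
   its global existence is part of admissibility. *)
Definition admissible F (k0 : R) : set (R -> R) :=
  [set c | [/\ L1_loc c,
      {ae @lebesgue_measure R, forall t : R, 0 <= t -> 0 <= c t} &
      exists k : R -> R, is_trajectory F k0 c k /\
        forall t : R, 0 <= t -> 0 <= k t]].

Definition total_utility u (rho : R) c : \bar R :=
  (\int[@lebesgue_measure R]_(t in `[0%R, +oo[)
     (expR (- rho * t) * u (c t))%:E)%E.

Definition value_function F u (rho k0 : R) : \bar R :=
  ereal_sup [set total_utility u rho c | c in admissible F k0].

End optimal_growth.

(* Main.v *)
Require Import Defs.
From HB Require Import structures.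
From mathcomp Require Import all_boot all_order all_algebra.
From mathcomp Require Import all_classical all_reals all_analysis.
From mathcomp Require Import measurable_realfun ess_sup_inf lra ring.

Set Implicit Arguments.
Unset Strict Implicit.
Unset Printing Implicit Defensive.

Import Order.TTheory GRing.Theory Num.Theory.
Import numFieldNormedType.Exports.

Local Open Scope classical_set_scope.
Local Open Scope ring_scope.

(* A control enters the state equation only through its running integral
   C(t) = \int_0^t c, and F is increasing; so if k >= 0 satisfies
   k(t) <= k0 + \int_0^t F(k) - C(t), a monotone Picard iteration started at k
   yields a trajectory above k. Hence admissibility is stable under lowering C,
   and under limits of C, with no concavity of F needed.

   Consuming at most N on [0, T] and eating the capital saved during ]T, T+1]
   lowers C and, since u' vanishes at infinity, does not lower the utility once
   N is large, N depending only on T and k0. There is thus a maximizing sequence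
   c_n bounded on each [0, T] uniformly in n, along which C_n converges pointwise.
   Midpoint combinations of the tails (c_n)_(n >= m) that almost minimize a weighted
   L^2 norm are Cauchy by the parallelogram identity, hence converge a.e. along a
   subsequence to some c with running integral lim C_n; since u is concave and
   the tails \int_T^oo e^(- rho t) u(c_n) are uniformly small, c is optimal. The
   limsup of the trajectories of the c_n is a subsolution for c. *)

(** * Absolutely continuous functions with vanishing derivative *)

(** Since [F] is not concave, midpoints of admissible controls may fail to be admissible. The
    combinations therefore serve only to produce the limit control: they keep an exponential bound
    on cumulative consumption, which is all the utility estimates ask for, and admissibility of the
    limit is recovered from the original sequence, whose running integrals have the same limit.

    The smallness of the tails rests on a gap between two growth rates. As [F'] tends to [L],
    cumulative consumption is at most a multiple of e^(a t) for any a > L, while the discount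
    condition controls e^(- rho t) u(e^(lam t)) for lam = L + eps0. Taking a < lam bounds the
    integral of e^(- lam t) c(t) uniformly in c.

    The bound on [0, T] that is uniform in the control excludes concentration: a maximizing sequence
    bounded only in L^1 could gather its consumption near one instant, and the limit of the running
    integrals could then jump. *)

Section absolute_continuity.
Context {R : realType}.
Notation mu := (@lebesgue_measure R).

(* Cousin's covering lemma, as an induction principle on [0, T]. *)
Lemma interval_step_induction (T : R) (P : R -> Prop) : 0 <= T -> P 0 ->
  (forall x, 0 <= x <= T -> exists2 eta, 0 < eta &
    forall y z, 0 <= y -> x - eta < y -> y <= x -> x <= z -> z < x + eta ->
      z <= T -> y < z -> P y -> P z) -> P T.
Proof.
move=> T0 P0 step.
pose S := [set x | 0 <= x <= T /\ P x].
have S0 : S 0 by split => //; rewrite lexx.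
have supS : has_sup S by split; [exists 0|exists T => x [/andP[]]].
have s0 : 0 <= sup S by apply: ub_le_sup => //; case: supS.
have sT : sup S <= T by apply: ge_sup; [exists 0|move=> x [/andP[]]].
have [|eta eta0 H] := step (sup S); first by rewrite s0.
have [y [/andP[y0 yT] Py] yS] := sup_adherent eta0 supS.
have yS' : y <= sup S by apply: ub_le_sup; [case: supS|split=> //; apply/andP].
have Pz z : sup S <= z -> z < sup S + eta -> z <= T -> P z.
  move=> Sz zS zT; have := le_trans yS' Sz; rewrite le_eqVlt => /orP[/eqP<-//|yz].
  by apply: (H y z).
have [h|h] := ltP T (sup S + eta); first exact: Pz.
have /le_lt_trans := h.
suff : sup S + eta / 2 <= sup S by lra.
apply: ub_le_sup; first by case: supS.
split; first lra. apply: Pz; lra.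
Qed.

Lemma is_derive0_small (g : R -> R) (x e : R) : is_derive x 1 g 0 -> 0 < e ->
  exists2 eta, 0 < eta & forall y, `|y - x| < eta -> `|g y - g x| <= e * `|y - x|.
Proof.
move=> [dg vg] e0; move: dg vg; rewrite /derivable /derive => dg vg.
have /cvgrPdist_le/(_ e e0) : h^-1 *: (g (h *: 1 + x) - g x) @[h --> 0^'] --> (0:R).
  by apply: cvg_toP => //; exact: dg.
move/nbhs_ballP => [eta /= eta0 H]; exists eta => // y yx.
have [->|yx0] := eqVneq y x; first by rewrite !subrr normr0 mulr0.
have := H (y - x); rewrite /ball /= sub0r normrN => /(_ yx).
rewrite subr_eq0 => /(_ yx0).
rewrite sub0r normrN /GRing.scale /= mulr1 subrK normrM normfV.
by rewrite mulrC ler_pdivrMr// normr_gt0 subr_eq0.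
Qed.

(** The exceptional null set is enclosed in an open set whose measure is below the modulus of
    absolute continuity. Near a point of this open set, a step is charged to the absolutely
    continuous sum; near any other point the derivative is 0 and a step costs at most [e1] times its
    length. Cousin's induction glues the steps, in place of a Vitali covering. *)
Lemma ac_derive0_const (T : R) (g : R -> R) : 0 <= T ->
  absolutely_continuous_on 0 T g ->
  {ae mu, forall t : R, 0 <= t -> is_derive t 1 g 0} -> g T = g 0.
Proof.
move=> T0 ac [N [mN N0 subN]].
apply/eqP; rewrite -subr_eq0 -normr_eq0 eq_le normr_ge0 andbT.
apply/ler_addgt0Pl => e e0; rewrite addr0.
have [e1 e10 e1T] : exists2 e1, 0 < e1 & e1 * T <= e / 2.
  exists (e / 2 / (T + 1)); first by rewrite !divr_gt0// ltr_wpDl.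
  rewrite mulrAC ler_pdivrMr; last lra.
  by apply: ler_wpM2l; lra.
have [d d0 Hd] := ac (e / 2) ltac:(lra).
have Noo : (mu N < +oo)%E by rewrite [X in (X < _)%E]N0 ltry.
have [U [oO NO muO]] := lebesgue_regularity_outer mN Noo d0.
have mO : measurable U by exact: open_measurable.
have muO2 : (mu U < d%:E)%E.
  rewrite (le_lt_trans _ muO)//.
  rewrite -[in leLHS](setDUK NO) (le_trans (measureU2 _ _ _))//.
    exact: measurableD.
  by rewrite [X in (X + _)%E]N0 add0e.
(* Q x: on [0, x], g moves by at most e1 * x plus its increments over disjoint
   intervals inside U, so that mu U < d makes the latter small. *)
pose Q x := exists s : seq (R * R),
 [/\ all (fun p => [&& 0 <= p.1, p.1 < p.2 & p.2 <= x]) s,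
     pairwise (fun p q => q.2 <= p.1) s,
     ((\sum_(p <- s) (p.2 - p.1))%:E <= mu (U `&` `]0%R, x]))%E &
     `|g x - g 0| <= e1 * x + \sum_(p <- s) `|g p.2 - g p.1|].
have : Q T.
  apply: interval_step_induction => //.
    by exists [::]; split=> //; rewrite !big_nil// ?mulr0 ?addr0 ?subrr ?normr0.
  move=> x /andP[x0 xT].
  have [xO|xO] := pselect (U x).
    have /nbhs_ballP[eta eta0 Heta] : nbhs x U by exact: open_nbhs_nbhs.
    exists eta => // y z y0 xy yx xz zx zT yz [s [s1 s2 s3 s4]].
    exists ((y, z) :: s); split.
    - rewrite /= y0 yz lexx/=; apply: sub_all s1 => p /and3P[-> -> /= h].
      by rewrite (le_trans h)// ltW.
    - rewrite /= s2 andbT; apply: sub_all s1 => p /and3P[_ _ /= h] //.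
    - rewrite big_cons /= EFinD.
      have -> : U `&` `]0, z]%classic = (U `&` `]0, y]%classic) `|` `]y, z]%classic.
        have -> : `]0, z]%classic = `]0, y]%classic `|` `]y, z]%classic.
          by rewrite -itv_bndbnd_setU// bnd_simp// ltW.
        rewrite setIUr; congr (_ `|` _); apply/setIidPr => r /=.
        rewrite in_itv/= => /andP[yr rz]; apply: Heta; rewrite /ball/=.
        by rewrite ltr_norml; apply/andP; split; lra.
      rewrite measureU//=.
      + rewrite addeC; apply: leeD => //.
        by rewrite lebesgue_measure_itv/= lte_fin yz -EFinB.
      + by apply: measurableI => //; exact: measurable_itv.
      + rewrite -subset0 => r /= [[_]].
        by rewrite !in_itv/= => /andP[_ h1] /andP[h2 _]; lra.
    - rewrite big_cons /=.
      have := ler_normD (g z - g y) (g y - g 0).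
      rewrite addrA subrK; have : e1 * y <= e1 * z by rewrite ler_pM2l// ltW.
      lra.
  have dg : is_derive x 1 g 0.
    apply: contrapT => h; apply: xO; apply: NO; apply: subN => /=.
    by move=> /(_ x0).
  have [eta eta0 Heta] := is_derive0_small dg e10.
  exists eta => // y z y0 xy yx xz zx zT yz [s [s1 s2 s3 s4]].
  exists s; split=> //.
  - apply: sub_all s1 => p /and3P[-> -> /= h].
    by rewrite (le_trans h)// ltW.
  - apply: (le_trans s3); apply: le_measure; rewrite ?inE.
    + by apply: measurableI => //; exact: measurable_itv.
    + by apply: measurableI => //; exact: measurable_itv.
    + apply: setIS; apply: subset_itvl; rewrite bnd_simp; exact: ltW.
  - have := ler_normD (g z - g x) (g x - g 0).
    have := ler_normD (g x - g y) (g y - g 0).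
    rewrite !addrA !subrK.
    have := Heta z; rewrite ger0_norm ?subr_ge0// => /(_ ltac:(lra)).
    have := Heta y; rewrite distrC ger0_norm ?subr_ge0// => /(_ ltac:(lra)).
    rewrite distrC; lra.
move=> [s [s1 s2 s3 s4]].
apply: (le_trans s4).
have : \sum_(p <- s) `|g p.2 - g p.1| < e / 2; last by lra.
rewrite (big_nth (0, 0)) big_mkord.
apply: (Hd (size s) (fun i => nth (0, 0) s i)).
- move=> i; have /(_ (nth (0,0) s i)) := allP s1.
  by rewrite mem_nth// => /(_ isT)/and3P[].
- apply/trivIsetP => i j _ _ ij; rewrite -subset0 => r /=.
  have [hi hj] : (i < size s)%N /\ (j < size s)%N by [].
  move/pairwiseP: s2 => /(_ (0,0)) H [].
  have [ltij|ltji|eqij] := ltngtP i j.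
  + have := H i j hi hj ltij; rewrite !in_itv/= => h /andP[h1 h2] /andP[h3 h4]; lra.
  + have := H j i hj hi ltji; rewrite !in_itv/= => h /andP[h1 h2] /andP[h3 h4]; lra.
  + by move/ord_inj : eqij ij => ->; rewrite eqxx.
- have : (mu (U `&` `]0%R, T]) < d%:E)%E.
    apply: le_lt_trans muO2; apply: le_measure; rewrite ?inE//.
    by apply: measurableI => //; exact: measurable_itv.
  by move=> /(le_lt_trans s3); rewrite lte_fin (big_nth (0,0)) big_mkord.
Qed.
End absolute_continuity.

(** * Running integrals and the integral form of the state equation *)

Section running_integral.
Context {R : realType}.
Notation mu := (@lebesgue_measure R).
Implicit Types (F f g h c k : R -> R) (t x y : R).

Definition cum f t : R := (\int[mu]_(s in `[0, t]) f s)%R.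

Lemma L1_loc_int f t : L1_loc f -> mu.-integrable `[0, t] (EFin \o f).
Proof.
move=> lf; have : 0 < Num.max t 1 by rewrite lt_max ltr01 orbT.
move=> /lf; apply: integrableS => //.
by apply: subset_itvl; rewrite bnd_simp le_max lexx.
Qed.

Lemma L1_locD f g : L1_loc f -> L1_loc g -> L1_loc (f \+ g).
Proof. by move=> lf lg T T0; apply: (integrableD _ (lf T T0) (lg T T0)). Qed.

Lemma L1_locB f g : L1_loc f -> L1_loc g -> L1_loc (f \- g).
Proof. by move=> lf lg T T0; apply: (integrableB _ (lf T T0) (lg T T0)). Qed.

Lemma eq_L1_loc f g : (forall t, 0 <= t -> f t = g t) -> L1_loc f -> L1_loc g.
Proof.
move=> fg lf T T0; apply: eq_integrable (lf T T0) => //= x.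
by rewrite inE/= in_itv/= => /andP[x0 _]; rewrite fg.
Qed.

Lemma L1_loc_bounded f : (forall T : R, 0 < T -> measurable_fun `[0, T] f) ->
  (forall T, 0 < T -> exists M, forall t, 0 <= t <= T -> `|f t| <= M) -> L1_loc f.
Proof.
move=> mf bf T T0; have [B HB] := bf T T0.
apply: measurable_bounded_integrable => //=.
- by rewrite lebesgue_measure_itv/= lte_fin T0 -EFinB ltry.
- exact: mf.
- exists B; split; rewrite ?num_real// => M BM x /=; rewrite in_itv/= => xT.
  by rewrite (le_trans (HB _ xT))// ltW.
Qed.

Lemma L1_loc_continuous f : (forall T, 0 < T -> {within `[0, T], continuous f}) ->
  L1_loc f.
Proof.
move=> cf T T0; apply: continuous_compact_integrable; last exact: cf.
exact: segment_compact.
Qed.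

Lemma eq_cum f g t : (forall s, 0 <= s <= t -> f s = g s) -> cum f t = cum g t.
Proof. by move=> fg; apply: eq_Rintegral => s; rewrite inE/= in_itv => /fg. Qed.

Lemma cumD f g t : L1_loc f -> L1_loc g -> cum (f \+ g) t = cum f t + cum g t.
Proof. by move=> lf lg; rewrite /cum RintegralD//; exact: L1_loc_int. Qed.

Lemma cumB f g t : L1_loc f -> L1_loc g -> cum (f \- g) t = cum f t - cum g t.
Proof. by move=> lf lg; rewrite /cum RintegralB//; exact: L1_loc_int. Qed.

Lemma cum_le f g t : L1_loc f -> L1_loc g ->
  (forall s, 0 <= s <= t -> f s <= g s) -> cum f t <= cum g t.
Proof.
move=> lf lg fg; apply: le_Rintegral; [by []|exact: L1_loc_int..|].
by move=> s /=; rewrite in_itv; exact: fg.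
Qed.

Lemma cum_ge0 f t : (forall s, 0 <= s <= t -> 0 <= f s) -> 0 <= cum f t.
Proof. by move=> f0; apply: Rintegral_ge0 => s /=; rewrite in_itv; exact: f0. Qed.

Lemma cum_le0 f t : t <= 0 -> cum f t = 0.
Proof.
rewrite le_eqVlt => /orP[/eqP->|t0].
  by rewrite /cum set_itv1 Rintegral_set1.
by rewrite /cum set_itv_ge ?Rintegral_set0// bnd_simp -ltNge.
Qed.

Lemma cum_split f s t : L1_loc f -> 0 <= s -> s <= t ->
  cum f t - cum f s = (\int[mu]_(r in `]s, t]) f r)%R.
Proof.
by move=> lf s0 st; rewrite /cum Rintegral_itvB ?bnd_simp//; exact: L1_loc_int.
Qed.

Lemma cum_cst (r t : R) : 0 <= t -> cum (fun=> r) t = r * t.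
Proof.
move=> t0; rewrite /cum Rintegral_cst//= lebesgue_measure_itv/= lte_fin.
case: ltP => [_|]; first by rewrite -EFinB subr0.
by move=> ?; rewrite (_ : t = 0) ?mulr0//; lra.
Qed.

Lemma cum_nd f : L1_loc f -> (forall s, 0 <= s -> 0 <= f s) ->
  {homo cum f : s t / s <= t}.
Proof.
move=> lf f0 s t st; have [s0|s0] := leP 0 s.
  rewrite -subr_ge0 cum_split//; apply: Rintegral_ge0 => r /=.
  by rewrite in_itv/= => /andP[h _]; apply: f0; lra.
by rewrite (@cum_le0 f s (ltW s0)); apply: cum_ge0 => r /andP[/f0].
Qed.

Lemma cum_measurable f : L1_loc f -> (forall s, 0 <= s -> 0 <= f s) ->
  measurable_fun setT (cum f).
Proof. by move=> lf f0; apply: nondecreasing_measurable => //; exact: cum_nd. Qed.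

(** The sum over the intervals is at most the integral of |f| over their union, so absolute
    continuity of the integral is applied to that single set. Cutting [f] off outside [0, T] makes
    it integrable on the whole line. *)
Lemma cum_ac T f : L1_loc f -> absolutely_continuous_on 0 T (cum f).
Proof.
move=> lf e e0.
have ig : mu.-integrable setT (EFin \o (f \_ `[0, T])).
  rewrite (_ : EFin \o _ = (EFin \o f) \_ `[0, T]); last first.
    by apply/funext => x; rewrite /= !patchE; case: ifP.
  by apply/integrable_restrict => //=; rewrite setTI; exact: L1_loc_int.
have [d [d0 Hd]] := integral_normr_continuous ig e0.
exists d => // n I HI tI sI.
pose J (i : 'I_n) := `](I i).1, (I i).2[%classic.
pose D := \big[setU/set0]_(i <- enum 'I_n) J i.
have mJ i : measurable (J i) by exact: measurable_itv.
have mD : measurable D by exact: bigsetU_measurable.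
have tJ : trivIset [set` enum 'I_n] J by apply: sub_trivIset tI.
have sumE h : measurable_fun setT h -> (forall x, 0 <= h x) ->
    (\int[mu]_(x in D) (h x)%:E = \sum_(i < n) \int[mu]_(x in J i) (h x)%:E)%E.
  move=> mh h0; rewrite /D ge0_integral_bigsetU//.
  - by rewrite big_enum.
  - exact: enum_uniq.
  - by apply/measurable_EFinP; exact: measurable_funTS.
  - by move=> x _; rewrite lee_fin.
have muD : (mu D < d%:E)%E.
  have m1 : measurable_fun setT (cst 1 : R -> R) by exact: measurable_cst.
  have := sumE (cst 1) m1 (fun=> ler01).
  have E1 A : measurable A -> (\int[mu]_(x in A) (@cst R R 1 x)%:E = mu A)%E.
    by move=> mA; rewrite -[RHS]mul1e -integral_cst.
  rewrite (E1 _ mD) => ->.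
  have E2 i : (\int[mu]_(x in J i) (@cst R R 1 x)%:E = ((I i).2 - (I i).1)%:E)%E.
    rewrite (E1 _ (mJ i)) /J lebesgue_measure_itv.
    rewrite /= lte_fin.
    by have [_ -> _] := HI i; rewrite -EFinB.
  rewrite (eq_bigr _ (fun i _ => E2 i)).
  by rewrite sumEFin lte_fin.
have mg : measurable_fun setT (f \_ `[0, T]).
  by apply/measurable_EFinP; case/integrableP: ig.
have /(_ D mD muD) := Hd.
apply: le_lt_trans.
rewrite -lee_fin /Rintegral fineK; last first.
  apply: integrable_fin_num => //.
  apply: (@integrable_norm _ _ _ mu D (f \_ `[0, T])).
  exact: integrableS ig.
rewrite sumE//; last exact: measurableT_comp.
rewrite -sumEFin; apply: lee_sum => i _.
have [ai ab bT] := HI i.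
have iJ : mu.-integrable (J i) (EFin \o f).
  apply: integrableS (L1_loc_int T lf) => //.
    exact: mJ.
  by rewrite /J; apply: subset_itv; rewrite bnd_simp.
rewrite cum_split//; last exact: ltW.
rewrite -Rintegral_itv_bndo_bndc; last first.
  apply: integrableS (L1_loc_int T lf) => //.
  by apply: subset_itv; rewrite bnd_simp.
rewrite EFin_normr_Rintegral; [|exact: mJ|exact: iJ].
have -> : (\int[mu]_(x in J i) `|(f \_ `[0%R, T]) x|%:E =
           \int[mu]_(x in J i) `|(EFin \o f) x|)%E.
  apply: eq_integral => x; rewrite inE /J /= in_itv/= => /andP[h1 h2].
  by rewrite patchE mem_set//= in_itv/=; apply/andP; split; lra.
by apply: (le_abse_integral mu (mJ i)); case/integrableP: iJ.
Qed.

Lemma ac_sub a b f g : absolutely_continuous_on a b f ->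
  absolutely_continuous_on a b g -> absolutely_continuous_on a b (f \- g).
Proof.
move=> af ag e e0; have e20 : 0 < e / 2 by lra.
have [d1 d10 H1] := af _ e20; have [d2 d20 H2] := ag _ e20.
exists (Num.min d1 d2); first by rewrite lt_min d10.
move=> n I HI tI; rewrite lt_min => /andP[s1 s2].
have h1 := H1 n I HI tI s1; have h2 := H2 n I HI tI s2.
apply: (@le_lt_trans _ _ (\sum_(i < n) (`|f (I i).2 - f (I i).1| + `|g (I i).2 - g (I i).1|))).
  apply: ler_sum => i _.
  rewrite (_ : _ - _ = (f (I i).2 - f (I i).1) - (g (I i).2 - g (I i).1)); last by rewrite /=; lra.
  exact: ler_normB.
by rewrite big_split/=; lra.
Qed.

Lemma ac_cst a b (r : R) : absolutely_continuous_on a b (fun=> r).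
Proof.
move=> e e0; exists 1 => // n I _ _ _.
by rewrite big1// => i _; rewrite subrr normr0.
Qed.

Lemma ac_continuous T f : absolutely_continuous_on 0 T f ->
  {within `[0, T], continuous f}.
Proof.
move=> af; apply/subspace_continuousP => x /=; rewrite in_itv/= => /andP[x0 xT].
apply/cvgrPdist_lt => e e0; have [d d0 Hd] := af e e0.
have key a b : 0 <= a -> a < b -> b <= T -> b - a < d -> `|f b - f a| < e.
  move=> a0 ab bT bad; have := Hd 1%N (fun=> (a, b)).
  rewrite !big_ord1/=; apply => //.
  by apply/trivIsetP => i j _ _; rewrite !ord1 eqxx.
rewrite near_withinE; apply/nbhs_ballP; exists d => //= y.
rewrite /ball/= => xy; rewrite in_itv/= => /andP[y0 yT].
have [lt|lt|->] := ltgtP x y.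
- by rewrite distrC; apply: key => //; move: xy; rewrite ltr_norml; lra.
- by apply: key => //; move: xy; rewrite ltr_norml; lra.
- by rewrite subrr normr0.
Qed.

Lemma L1_loc_measurable f : L1_loc f -> measurable_fun (`[0, +oo[%classic : set R) f.
Proof.
move=> lf; rewrite itv0y_bigcup0S; apply/measurable_fun_bigcup => // n.
by have /lf/integrableP[/measurable_EFinP] : (0:R) < n.+1%:R by [].
Qed.

(** Lebesgue differentiation, applied to the extension of [f] by 0, which is locally integrable on
    the whole line. The derivative is two-sided and [FTC1] speaks of points beyond the left endpoint
    only, so the null point 0 is discarded. *)
Lemma cum_is_derive f : L1_loc f ->
  {ae mu, forall t : R, 0 <= t -> is_derive t 1 (cum f) (f t)}.
Proof.
move=> lf; pose g := f \_ `[0, +oo[.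
have mg : measurable_fun setT g.
  by apply/(measurable_restrictT f) => //; exact: L1_loc_measurable.
have gf t : 0 <= t -> g t = f t.
  by move=> t0; rewrite /g patchE mem_set//= in_itv/= t0.
have lg : L1_loc g by apply: eq_L1_loc lf => t /gf.
have cgf : cum g = cum f by apply/funext => t; apply: eq_cum => s /andP[/gf].
have locg : locally_integrable setT g.
  split => //; first exact: openT.
  move=> K _ cK; have [M [_ HM]] := compact_bounded cK.
  pose M1 := `|M| + 1; have M10 : 0 < M1 by rewrite ltr_wpDl.
  have KM x : K x -> `|x| <= M1.
    by apply: HM; rewrite /M1 (le_lt_trans (ler_norm M))// ltrDl.
  have mK : measurable K by exact: compact_measurable.
  have /integrableP[_] := lg M1 M10; apply: le_lt_trans.
  have mag : measurable_fun setT (EFin \o (fun x => `|g x|)).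
    by apply/measurable_EFinP; exact: measurableT_comp.
  rewrite integral_mkcond [leRHS]integral_mkcond; apply: ge0_le_integral => //.
  - by move=> x _; rewrite patchE; case: ifP.
  - apply/(measurable_restrictT (fun x => `|g x|%:E)) => //.
    exact: measurable_funTS.
  - apply/(measurable_restrictT (fun x => `|g x|%:E)) => //.
    exact: measurable_funTS.
  - move=> x _; rewrite !patchE; case: ifPn => xK.
      case: ifPn => // xM; rewrite lee_fin.
      rewrite /g patchE; case: ifPn => x0; last by rewrite normr0.
      exfalso; move: xM; apply/negP; rewrite negbK inE/= in_itv/=.
      move: x0; rewrite inE/= in_itv/= andbT => x0; rewrite x0/=.
      by apply: le_trans (ler_norm x) _; apply: KM; rewrite inE in xK.
    by case: ifPn => //; rewrite lee_fin.
have ae0 : {ae mu, forall t : R, t != 0}.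
  exists [set 0]; split; [exact: measurable_set1|exact: lebesgue_measure_set1|].
  by move=> t /= /negP; rewrite negbK => /eqP.
have := @FTC1 R g (BLeft 0) (fun y => L1_loc_int y lg) locg.
move: ae0; apply: filterS2; first exact: (ae_filter_ringOfSetsType mu).
move=> t tn0 H t0; have {H} := H; rewrite /= lte_fin lt_neqAle t0 eq_sym tn0.
move=> /(_ isT).
move=> [d1 d2]; rewrite -cgf -(gf t t0); split; first exact: d1.
by rewrite -derive1E; exact: d2.
Qed.

Definition integral_solution F (k0 : R) c k :=
  forall t : R, 0 <= t -> k t = k0 + cum (F \o k) t - cum c t.

(** The difference between [k] and the running integral of [F \o k \- c] is absolutely continuous
    with derivative 0 almost everywhere, hence constant. Continuity of [k] makes [F \o k] locally
    integrable. *)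
Lemma trajectory_integral F (k0 : R) c k : continuous F -> L1_loc c ->
  is_trajectory F k0 c k -> L1_loc (F \o k) /\ integral_solution F k0 c k.
Proof.
move=> cF lc [k00 ack dk].
have lFk : L1_loc (F \o k).
  apply: L1_loc_continuous => T T0.
  apply: within_continuous_comp; last exact: ac_continuous (ack T T0).
  by move=> x _; exact: cF.
split => // t t0.
have lh : L1_loc (F \o k \- c) by exact: L1_locB.
pose g := k \- cum (F \o k \- c).
suff : g t = g 0.
  by rewrite /g/= (@cum_le0 _ 0)// subr0 k00 cumB//; lra.
case: (ltP 0 t) => [t1|t1]; last by rewrite (_ : t = 0)//; lra.
apply: ac_derive0_const => //.
  by apply: ac_sub; [exact: ack|exact: cum_ac].
have := cum_is_derive lh; move: dk; apply: filterS2; first exact: (ae_filter_ringOfSetsType mu).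
move=> s /= H1 H2 s0.
have := H1 s0; have := H2 s0 => d2 d1.
have := is_deriveB d1 d2; by rewrite /= subrr.
Qed.

(** The integral equation is assumed at negative times too, where [cum] is 0 and [k] is thus [k0]:
    derivatives are transported along an equality of functions on the whole line. *)
Lemma integral_trajectory F (k0 : R) c k : L1_loc c -> L1_loc (F \o k) ->
  (forall t, k t = k0 + cum (F \o k) t - cum c t) -> is_trajectory F k0 c k.
Proof.
move=> lc lFk kE.
have lh : L1_loc (F \o k \- c) by exact: L1_locB.
split.
- by rewrite kE !cum_le0// addr0 subr0.
- move=> T T0.
  rewrite (_ : k = cum (F \o k \- c) \- (fun=> - k0)); last first.
    by apply/funext => t; rewrite kE /= cumB//; lra.
  by apply: ac_sub; [exact: cum_ac|exact: ac_cst].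
- have := cum_is_derive lh; apply: filterS; first exact: (ae_filter_ringOfSetsType mu).
  move=> t H t0.
  have kE2 : cst k0 + cum (F \o k \- c) = k.
    by apply/funext => s; rewrite [RHS]kE -[LHS]/(k0 + cum _ s) cumB//; lra.
  have := is_deriveD (is_derive_cst k0 t 1) (H t0).
  by rewrite [in X in X -> _]kE2 /= add0r.
Qed.
End running_integral.

(** * Gronwall's inequality and subsolutions of the state equation *)

Section state_equation.
Context {R : realType}.
Notation mu := (@lebesgue_measure R).
Implicit Types (F f g h c k : R -> R) (t x y : R).

Lemma cumZ (r : R) f t : L1_loc f -> cum (fun s => r * f s) t = r * cum f t.
Proof. by move=> lf; rewrite /cum RintegralZl//; exact: L1_loc_int. Qed.

Lemma L1_locZ (r : R) f : L1_loc f -> L1_loc (fun s => r * f s).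
Proof.
move=> lf T T0.
have -> : EFin \o (fun s => r * f s) = (fun s => r%:E * (EFin \o f) s)%E.
  by apply/funext => s /=; rewrite EFinM.
by apply: integrableZl => //; exact: lf.
Qed.

Lemma L1_loc_cst (r : R) : L1_loc (fun=> r : R).
Proof.
apply: L1_loc_bounded; last by move=> T _; exists `|r|.
by move=> T _; exact: measurable_cst.
Qed.

Lemma continuous_expRM (a : R) : continuous (fun t : R => expR (a * t)).
Proof.
by move=> t; apply: continuous_comp; [exact: mulrl_continuous|exact: continuous_expR].
Qed.

Lemma L1_loc_exp (a : R) : L1_loc (fun t : R => expR (a * t)).
Proof.
by apply: L1_loc_continuous => T _; apply: continuous_subspaceT; exact: continuous_expRM.
Qed.

Lemma cum_exp (a t : R) : a != 0 -> 0 <= t ->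
  cum (fun s => expR (a * s)) t = (expR (a * t) - 1) / a.
Proof.
move=> a0; rewrite le_eqVlt => /orP[/eqP<-|t0].
  by rewrite cum_le0// mulr0 expR0 subrr mul0r.
pose G (s : R) : R := expR (a * s) / a.
have dG (s : R) : is_derive s 1 G (expR (a * s)).
  have d1 : is_derive s 1 ( *%R a) a.
    have := is_deriveZ a (is_derive_id s 1).
    by rewrite /GRing.scale/= mulr1.
  have d2 := is_derive1_comp (is_derive_expR (a * s)) d1.
  have := is_deriveZ a^-1 d2.
  rewrite [X in is_derive _ _ X _](_ : _ = G); last first.
    by apply/funext => r; rewrite /G mulrC.
  by rewrite /GRing.scale /= mulrCA mulVf// mulr1.
have cG : continuous G.
  by move=> s; apply: differentiable_continuous; apply/derivable1_diffP; case: (dG s).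
rewrite /cum /Rintegral (@continuous_FTC2 _ _ G)//.
- by rewrite /= /G mulr0 expR0; field.
- by apply: continuous_subspaceT; exact: continuous_expRM.
- split.
  + by move=> s _; case: (dG s).
  + by apply: cvg_at_right_filter; exact: cG.
  + by apply: cvg_at_left_filter; exact: cG.
- by move=> s _; rewrite derive1E; case: (dG s).
Qed.

Lemma gronwall (a : R) (D : R -> R) : 0 < a -> L1_loc D ->
  (forall T, exists M, forall t, 0 <= t <= T -> D t <= M) ->
  (forall t, 0 <= t -> D t <= a * cum D t) ->
  forall t, 0 <= t -> D t <= 0.
Proof.
move=> a0 lD bD HD T T0; have [M HM] := bD T.
pose M1 := Num.max M 0.
(* Each use of the hypothesis gains a factor 1/2 against the weight e^(2at). *)
have key n t : 0 <= t <= T -> D t <= M1 * (2^-1) ^+ n * expR (a * 2 * t).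
  elim: n t => [|n IH] t /andP[t0 tT].
    rewrite expr0 mulr1; apply: (le_trans (HM t _)); first by rewrite t0.
    apply: (@le_trans _ _ M1); first by rewrite le_max lexx.
    rewrite ler_peMr//; first by rewrite le_max lexx orbT.
    by rewrite -expR0 ler_expR !mulr_ge0// ltW.
  apply: (le_trans (HD t t0)).
  apply: (@le_trans _ _ (a * cum (fun s => M1 * 2^-1 ^+ n * expR (a * 2 * s)) t)).
    rewrite ler_pM2l//; apply: cum_le => //.
      by apply: L1_locZ; exact: L1_loc_exp.
    by move=> s /andP[s0 st]; apply: IH; rewrite s0 (le_trans st).
  rewrite cumZ; last exact: L1_loc_exp.
  rewrite cum_exp//; last by rewrite mulf_neq0// gt_eqF.
  rewrite (_ : a * _ = M1 * 2^-1 ^+ n.+1 * (expR (a * 2 * t) - 1)); last first.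
    by rewrite exprS; field; rewrite gt_eqF.
  rewrite ler_wpM2l//; last by lra.
  by rewrite mulr_ge0 ?exprn_ge0// le_max lexx orbT.
have cv : M1 * (2^-1) ^+ n * expR (a * 2 * T) @[n --> \oo] --> (0 : R).
  rewrite (_ : 0 = M1 * 0 * expR (a * 2 * T)); last by rewrite mulr0 mul0r.
  apply: cvgM; last exact: cvg_cst.
  apply: cvgM; first exact: cvg_cst.
  by apply: cvg_expr; rewrite ger0_norm//; lra.
rewrite -(cvg_lim _ cv)//; apply: limr_ge; first by apply/cvg_ex; exists 0.
by apply: nearW => n; apply: key; rewrite T0 lexx.
Qed.

(** The function [(k0 + b) * expR (a * t)] solves the shifted equation with equality; subtracting it
    leaves the homogeneous inequality of [gronwall]. *)
Lemma gronwall_exp (a b k0 : R) k : 0 < a -> L1_loc k ->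
  (forall T, exists M, forall t, 0 <= t <= T -> k t <= M) ->
  (forall t, 0 <= t -> k t <= k0 + cum (fun s => a * (k s + b)) t) ->
  forall t, 0 <= t -> k t + b <= (k0 + b) * expR (a * t).
Proof.
move=> a0 lk bk Hk.
pose D := (k \+ (fun=> b)) \- (fun t => (k0 + b) * expR (a * t)).
have lkb : L1_loc (k \+ (fun=> b)) by apply: L1_locD => //; exact: L1_loc_cst.
have lE : L1_loc (fun t : R => (k0 + b) * expR (a * t)).
  by apply: L1_locZ; exact: L1_loc_exp.
have lD : L1_loc D by exact: L1_locB.
suff H t : 0 <= t -> D t <= 0 by move=> t /H; rewrite /D/= subr_le0.
move: t; apply: (gronwall a0 lD) => [T|t t0].
  have [M HM] := bk T.
  exists (M + b + `|k0 + b| * expR (a * T)) => t tT; rewrite /D /=.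
  have := HM t tT; have : - ((k0 + b) * expR (a * t)) <= `|k0 + b| * expR (a * T).
    apply: (le_trans (ler_norm _)); rewrite normrN normrM; apply: ler_wpM2l => //.
    rewrite ger0_norm ?expR_ge0// ler_expR ler_pM2l//; by case/andP: tT.
  by lra.
rewrite /D cumB// cumZ; last exact: L1_loc_exp.
rewrite cum_exp ?gt_eqF//= mulrBr -cumZ//.
rewrite (_ : a * ((k0 + b) * _) = (k0 + b) * (expR (a * t) - 1)); last first.
  by field; rewrite gt_eqF.
have := Hk t t0; lra.
Qed.

Lemma cum_dominated (f_ : nat -> R -> R) f (M t : R) :
  (forall n, measurable_fun `[0, t] (f_ n)) -> measurable_fun `[0, t] f ->
  {ae mu, forall s : R, 0 <= s <= t -> f_ n s @[n --> \oo] --> f s} ->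
  (forall n s, 0 <= s <= t -> `|f_ n s| <= M) ->
  cum (f_ n) t @[n --> \oo] --> cum f t.
Proof.
move=> mf_ mf fcv fM.
have mufin : (mu `[0%R, t] < +oo)%E.
  by rewrite lebesgue_measure_itv/=; case: ifP => _; rewrite -?EFinB ltry.
have iM : mu.-integrable `[0, t] (EFin \o (fun=> M)).
  apply: measurable_bounded_integrable => //=.
  exists `|M|; split; rewrite ?num_real// => r Mr x _; exact: ltW.
have H1 : {ae mu, forall s, `[0, t]%classic s ->
    (fun n => (f_ n s)%:E) @ \oo --> (f s)%:E}.
  move: fcv; apply: filterS; first exact: (ae_filter_ringOfSetsType mu).
  move=> s + /= st; rewrite in_itv/= in st => /(_ st) cv.
  by apply: cvg_EFin => //; exact: nearW.
have H2 : {ae mu, forall s n, `[0, t]%classic s -> (`|(f_ n s)%:E| <= M%:E)%E}.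
  by apply: aeW => s n /=; rewrite in_itv/= lee_fin => /fM.
case: (@dominated_convergence _ _ R mu _ (measurable_itv `[0, t])
    (fun n => EFin \o f_ n) (EFin \o f) (EFin \o (fun=> M))) => //.
- by move=> n; apply/measurable_EFinP; exact: mf_.
- exact/measurable_EFinP.
move=> i1 _ i3.
apply: fine_cvg.
have -> : (cum f t)%:E = (\int[mu]_(s in `[0%R, t]) (f s)%:E)%E.
  by rewrite /cum /Rintegral fineK//; exact: integrable_fin_num i1.
exact: i3.
Qed.

(** The affine bound is factored as [a * (x + b)] so that the shifted capital [k + b] obeys a linear
    inequality and is bounded by a pure exponential. *)
Definition growth_bound F (a b : R) := [/\ continuous F,
  (forall x y, x <= y -> F x <= F y), F 0 = 0, 0 < a /\ 0 <= b &
  forall x, 0 <= x -> F x <= a * (x + b)].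

(** A relaxed nonnegative trajectory: an inequality between measurable, locally bounded functions
    survives both a decrease of consumption and a limsup. *)
Definition subsolution F (k0 : R) c k :=
  [/\ measurable_fun setT k, (forall t, 0 <= t -> 0 <= k t),
      (forall T, exists M, forall t, 0 <= t <= T -> k t <= M) &
      forall t, 0 <= t -> k t <= k0 + cum (F \o k) t - cum c t].

Section dynamics.
Variables (F : R -> R) (a b : R).
Hypothesis HF : growth_bound F a b.

Lemma production_measurable : measurable_fun setT F.
Proof. by case: HF => cF _ _ _ _; exact: continuous_measurable_fun. Qed.

Lemma production_ge0 x : 0 <= x -> 0 <= F x.
Proof. by case: HF => _ ndF F0 _ _ /ndF; rewrite F0. Qed.

Lemma L1_loc_compF k : measurable_fun setT k -> (forall t, 0 <= t -> 0 <= k t) ->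
  (forall T, exists M, forall t, 0 <= t <= T -> k t <= M) -> L1_loc (F \o k).
Proof.
move=> mk k_ge0 bk; apply: L1_loc_bounded => T _.
  apply: measurable_funTS; apply: measurableT_comp => //; exact: production_measurable.
have [M HM] := bk T; exists (F M) => t /= tT.
rewrite ger0_norm; last by apply: production_ge0; apply: k_ge0; case/andP: tT.
by case: HF => _ ndF _ _ _; apply: ndF; exact: HM.
Qed.

(** Dropping consumption leaves a Gronwall inequality for [k]. Using [0 <= k] in the same inequality
    then bounds cumulative consumption by the integral of that estimate, uniformly in [c] and
    [k]. *)
Lemma subsolution_bound (k0 : R) c k : L1_loc c -> (forall t, 0 <= t -> 0 <= c t) ->
  subsolution F k0 c k ->
  forall t, 0 <= t -> k t + b <= (k0 + b) * expR (a * t) /\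
    cum c t <= (k0 + b) * expR (a * t).
Proof.
move=> lc c0 [mk k_ge0 bk Hk].
have [_ _ _ [a0 b0] Fab] := HF.
have lFk : L1_loc (F \o k) by exact: L1_loc_compF.
have lk : L1_loc k.
  apply: L1_loc_bounded => T _; first exact: measurable_funTS.
  have [M HM] := bk T; exists M => t tT; rewrite ger0_norm; first exact: HM.
  by apply: k_ge0; case/andP: tT.
have lkb : L1_loc (fun s => a * (k s + b)).
  by apply: L1_locZ; apply: (@L1_locD _ k (fun=> b)) => //; exact: L1_loc_cst.
have Fle t : 0 <= t -> cum (F \o k) t <= cum (fun s => a * (k s + b)) t.
  by move=> t0; apply: cum_le => // s /andP[s0 _]; apply: Fab; exact: k_ge0.
have c_ge0 t : 0 <= cum c t by apply: cum_ge0 => s /andP[+ _]; exact: c0.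
have Hb : forall t, 0 <= t -> k t + b <= (k0 + b) * expR (a * t).
  apply: (gronwall_exp a0 lk bk) => t t0.
  by have := Hk t t0; have := Fle t t0; have := c_ge0 t; lra.
move=> t t0; split; first exact: Hb.
have : cum (fun s => a * (k s + b)) t <= cum (fun s => a * (k0 + b) * expR (a * s)) t.
  apply: cum_le => //; first by apply: L1_locZ; exact: L1_loc_exp.
  by move=> s /andP[s0 _]; rewrite -mulrA ler_pM2l//; exact: Hb.
rewrite [in X in _ <= X]cumZ; last exact: L1_loc_exp.
rewrite cum_exp ?gt_eqF//.
rewrite (_ : a * (k0 + b) * _ = (k0 + b) * (expR (a * t) - 1)); last first.
  by field; rewrite gt_eqF.
by have := Hk t t0; have := Fle t t0; have := k_ge0 t t0; lra.
Qed.

(* Monotone Picard iteration started at the subsolution. *)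
Fixpoint picard (k0 : R) c k n : R -> R :=
  if n is m.+1 then fun t => k0 + cum (F \o picard k0 c k m) t - cum c t else k.

(** The subsolution inequality says that the first iterate is above [k], and monotonicity of [F]
    propagates this. Every iterate is again a subsolution, so [subsolution_bound] bounds the
    increasing sequence, and dominated convergence makes its limit a fixed point. *)
Lemma subsolution_admissible (k0 : R) c k : L1_loc c -> (forall t, 0 <= t -> 0 <= c t) ->
  0 <= k0 -> subsolution F k0 c k -> admissible F k0 c.
Proof.
move=> lc c0 k00 subk.
have [_ ndF F0 [a0 b0] Fab] := HF.
have Ekn n : subsolution F k0 c (picard k0 c k n) /\
    forall t, 0 <= t -> picard k0 c k n t <= picard k0 c k n.+1 t.
  elim: n => [|n [[mk k_ge0 bk Hk] nd]].
    by split => // t t0; case: subk => _ _ _; exact.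
  set kn := picard k0 c k n in mk k_ge0 bk Hk nd *.
  have lF := L1_loc_compF mk k_ge0 bk.
  have mk1 : measurable_fun setT (picard k0 c k n.+1).
    apply: measurable_funB; last exact: cum_measurable.
    apply: measurable_funD => //; apply: cum_measurable => // s s0.
    by apply: production_ge0; exact: k_ge0.
  have k1_ge0 t : 0 <= t -> 0 <= picard k0 c k n.+1 t.
    by move=> t0; apply: le_trans (nd t t0); exact: k_ge0.
  have bk1 T : exists M, forall t, 0 <= t <= T -> picard k0 c k n.+1 t <= M.
    exists (k0 + cum (F \o kn) T) => t /andP[t0 tT] /=.
    have := @cum_ge0 _ c t (fun s H => c0 s (andP H).1).
    have : cum (F \o kn) t <= cum (F \o kn) T.
      by apply: cum_nd => // s s0; apply: production_ge0; exact: k_ge0.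
    rewrite -/kn; lra.
  have nd1 t : 0 <= t -> picard k0 c k n.+1 t <= picard k0 c k n.+2 t.
    move=> t0; rewrite /= lerD2r lerD2l; apply: cum_le => //.
      exact: L1_loc_compF.
    by move=> s /andP[s0 _] /=; apply: ndF; exact: nd.
  by split => //; split.
have up n t : 0 <= t -> picard k0 c k n t <= (k0 + b) * expR (a * t).
  by move=> t0; have [/subsolution_bound H _] := Ekn n; have [] := H lc c0 t t0; lra.
have cvk t : 0 <= t -> cvgn (fun n => picard k0 c k n t).
  move=> t0; apply: nondecreasing_is_cvgn.
    by apply/nondecreasing_seqP => n; exact: (Ekn n).2.
  by exists ((k0 + b) * expR (a * t)) => _ [n _ <-]; exact: up.
pose l t := limn (fun n => picard k0 c k n t).
have l_ge0 t : 0 <= t -> 0 <= l t.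
  move=> t0; apply: limr_ge; first exact: cvk.
  by apply: nearW => n; have [[_ + _ _] _] := Ekn n; exact.
have l_le t : 0 <= t -> l t <= (k0 + b) * expR (a * t).
  by move=> t0; apply: limr_le; [exact: cvk|apply: nearW => n; exact: up].
have k0b : 0 <= k0 + b by lra.
have exp_le t T : t <= T -> (k0 + b) * expR (a * t) <= (k0 + b) * expR (a * T).
  by move=> tT; apply: ler_wpM2l => //; rewrite ler_expR ler_pM2l.
have ml (T : R) : measurable_fun `[0, T] (l : R -> R).
  apply: (@measurable_fun_cvg _ _ _ _ (picard k0 c k)).
    by move=> n; apply: measurable_funTS; case: (Ekn n) => -[].
  by move=> t /=; rewrite in_itv/= => /andP[t0 _]; exact: cvk.
have lFl : L1_loc (F \o l).
  apply: L1_loc_bounded => T _.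
    by apply: measurableT_comp => //; exact: production_measurable.
  exists (F ((k0 + b) * expR (a * T))) => t /andP[t0 tT] /=.
  rewrite ger0_norm; last by apply: production_ge0; exact: l_ge0.
  by apply: ndF; apply: le_trans (l_le t t0) _; exact: exp_le.
(* The limit [l] is controlled for [t >= 0] only; [kk] agrees with it there and satisfies the
   integral equation at negative times as well. *)
pose kk t := k0 + cum (F \o l) t - cum c t.
have kkl t : 0 <= t -> l t = kk t.
  move=> t0; apply/cvg_lim => //.
  rewrite -(cvg_shiftS (fun n => picard k0 c k n t)) /kk /=.
  apply: cvgB; last exact: cvg_cst.
  apply: cvgD; first exact: cvg_cst.
  apply: (@cum_dominated _ _ (F ((k0 + b) * expR (a * t)))).
  - move=> n; apply: measurable_funTS; apply: measurableT_comp; first exact: production_measurable.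
    by case: (Ekn n) => -[].
  - by apply: measurableT_comp => //; exact: production_measurable.
  - apply: aeW => s /andP[s0 _].
    apply: continuous_cvg; last exact: cvk.
    by case: HF => cF _ _ _ _; exact: cF.
  - move=> n s /andP[s0 st] /=; rewrite ger0_norm.
      by apply: ndF; apply: le_trans (up n s s0) _; exact: exp_le.
    by apply: production_ge0; case: (Ekn n) => -[_ + _ _] _; exact.
have ckk : cum (F \o kk) = cum (F \o l).
  by apply/funext => t; apply: eq_cum => s /andP[s0 _] /=; rewrite kkl.
split => //; first by apply: aeW.
exists kk; split; last by move=> t t0; rewrite -kkl//; exact: l_ge0.
apply: integral_trajectory => //; last by move=> t; rewrite ckk.
by apply: eq_L1_loc lFl => t t0 /=; rewrite kkl.
Qed.

End dynamics.
End state_equation.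

(** * Discounted utility: uniform control of the tails *)

Section utility.
Context {R : realType}.
Notation mu := (@lebesgue_measure R).
Implicit Types (F f g h c k : R -> R) (t x y : R).

Lemma L1_loc_le f g : measurable_fun setT f ->
  (forall t, 0 <= t -> `|f t| <= g t) -> L1_loc g -> L1_loc f.
Proof.
move=> mf fg lg T T0; apply: le_integrable (lg T T0) => //.
  by apply/measurable_EFinP; exact: measurable_funTS.
move=> x /=; rewrite in_itv/= => /andP[x0 _]; rewrite lee_fin.
by apply: le_trans (fg x x0) _; exact: ler_norm.
Qed.

Lemma cum_le_diff f g s t : L1_loc f -> L1_loc g -> 0 <= s -> s <= t ->
  (forall r, s < r <= t -> f r <= g r) -> cum f t - cum f s <= cum g t - cum g s.
Proof.
move=> lf lg s0 st fg; rewrite !cum_split//.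
have sub : `]s, t]%classic `<=` `[0, t]%classic.
  by move=> r /=; rewrite !in_itv/= => /andP[sr ->]; rewrite andbT; lra.
apply: le_Rintegral => //.
- exact: integrableS (L1_loc_int t lf).
- exact: integrableS (L1_loc_int t lg).
Qed.

Lemma expR_decay_le1 (r t : R) : 0 <= r -> 0 <= t -> expR (- r * t) <= 1.
Proof. by move=> r0 t0; rewrite -expR0 ler_expR mulNr oppr_le0 mulr_ge0. Qed.

Lemma expR_decay_le (r s t : R) : 0 <= r -> s <= t -> expR (- r * t) <= expR (- r * s).
Proof. by move=> r0 st; rewrite ler_expR !mulNr lerN2 ler_wpM2l. Qed.

(* p stands for u' and lam for L + eps0. *)
Definition utility_bounds (u p : R -> R) (rho lam eps M : R) : Prop :=
  [/\ (forall x y, 0 <= x -> x <= y -> u x <= u y), u 0 = 0,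
      continuous (fun x => u (Num.max x 0)),
      (forall y, 0 < y -> 0 < p y /\
         forall x, 0 <= x -> u x <= u y + p y * (x - y)) &
      forall t, 0 <= t -> expR (eps * t) * expR (- rho * t) * u (expR (lam * t)) <= M].

(* Changing a control on a null set and on the negative half-line turns it into
   a profile. *)
Definition profile c := [/\ measurable_fun setT c, (forall t, 0 <= c t) & L1_loc c].

(** What the utility estimates retain of the state equation; it passes to midpoints, whereas
    feasibility may not. *)
Definition budget (a K : R) c :=
  profile c /\ forall t, 0 <= t -> cum c t <= K * expR (a * t).

Section util.
Variables (u p : R -> R) (rho lam eps M : R).
Hypothesis Hu : utility_bounds u p rho lam eps M.
Hypothesis rho0 : 0 < rho.

Definition felicity c t : R := expR (- rho * t) * u (c t).

Lemma util_ge0 x : 0 <= x -> 0 <= u x.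
Proof. by case: Hu => nd u0 _ _ _ x0; rewrite -u0; exact: nd. Qed.

Lemma felicity_ge0 c t : 0 <= c t -> 0 <= felicity c t.
Proof. by move=> c0; rewrite mulr_ge0 ?expR_ge0 ?util_ge0. Qed.

Lemma felicity_measurable c : measurable_fun setT c -> (forall t, 0 <= c t) ->
  measurable_fun setT (felicity c).
Proof.
move=> mc c0; apply: measurable_funM.
  by apply: continuous_measurable_fun; exact: continuous_expRM.
rewrite (_ : (fun t => u (c t)) = (fun x => u (Num.max x 0)) \o c); last first.
  by apply/funext => t /=; rewrite max_l.
apply: measurableT_comp => //; apply: continuous_measurable_fun.
by case: Hu.
Qed.

Lemma felicity_L1 c : profile c -> L1_loc (felicity c).
Proof.
move=> [mc c0 lc].
have [nd _ _ Hp _] := Hu; have [p1 Hu1] := Hp 1 ltr01.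
apply: (@L1_loc_le _ (fun t => u 1 + p 1 * c t)).
- exact: felicity_measurable.
- move=> t t0; rewrite ger0_norm ?felicity_ge0//.
  apply: (@le_trans _ _ (u (c t))).
    by rewrite /felicity ler_piMl ?util_ge0// expR_decay_le1// ltW.
  by have := Hu1 (c t) (c0 t); lra.
- apply: (@L1_locD _ (fun=> u 1) (fun t => p 1 * c t)); first exact: L1_loc_cst.
  exact: L1_locZ.
Qed.

Section tail.
Variables (a K : R).
Hypothesis a0 : 0 < a.
Hypothesis alam : a < lam.
Hypothesis eps0 : 0 < eps.

Lemma budget_ge0 c : budget a K c -> 0 <= K.
Proof.
move=> [_ /(_ 0 (lexx _))].
by rewrite cum_le0// mulr0 expR0 mulr1.
Qed.

Lemma discount_bound_ge0 : 0 <= M.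
Proof.
have [_ _ _ _ /(_ 0 (lexx 0))] := Hu; apply: le_trans.
by rewrite !mulr0 expR0 !mul1r util_ge0.
Qed.

Lemma discount_exponent_ge0 : 0 <= lam. Proof. exact: ltW (lt_trans a0 alam). Qed.

Lemma decay_lt1 : expR (a - lam) < 1.
Proof. by rewrite -[ltRHS]expR0 ltr_expR subr_lt0. Qed.

(** The sum over n of e^(- lam n) K e^(a (n + 1)), a geometric series of ratio e^(a - lam). *)
Definition weighted_bound : R := K * expR a / (1 - expR (a - lam)).

Lemma weight_profile c : profile c -> profile (fun t => expR (- lam * t) * c t).
Proof.
move=> [mc c0 lc]; split.
- apply: measurable_funM => //.
  by apply: continuous_measurable_fun; exact: continuous_expRM.
- by move=> t; rewrite mulr_ge0 ?expR_ge0.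
apply: (@L1_loc_le _ c) => //.
- apply: measurable_funM => //.
  by apply: continuous_measurable_fun; exact: continuous_expRM.
- move=> t t0; rewrite ger0_norm ?mulr_ge0 ?expR_ge0//.
  by rewrite ler_piMl// expR_decay_le1// discount_exponent_ge0.
Qed.

(** On ]n, n+1] the weight is at most e^(- lam n), and the consumption up to n+1 is at most K e^(a
    (n + 1)). Summing over unit intervals replaces an integration by parts. *)
Lemma weighted_cum_nat c n : budget a K c ->
  cum (fun t => expR (- lam * t) * c t) n%:R <=
  K * expR a * (1 - expR (a - lam) ^+ n) / (1 - expR (a - lam)).
Proof.
move=> bc; have K0 := budget_ge0 bc; move: bc => [pc Hc].
have q1 := decay_lt1.
elim: n => [|n IH]; first by rewrite cum_le0// expr0 subrr mulr0 mul0r.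
have [_ _ lg] := weight_profile pc; have [_ c0 lc] := pc.
have nn : n%:R <= n.+1%:R :> R by rewrite ler_nat.
have : cum (fun t => expR (- lam * t) * c t) n.+1%:R -
       cum (fun t => expR (- lam * t) * c t) n%:R <=
       K * expR a * expR (a - lam) ^+ n.
  apply: (@le_trans _ _ (cum (fun t => expR (- lam * n%:R) * c t) n.+1%:R -
       cum (fun t => expR (- lam * n%:R) * c t) n%:R)).
    apply: cum_le_diff => //; first exact: L1_locZ.
    move=> r /andP[nr _]; by rewrite ler_wpM2r// expR_decay_le ?discount_exponent_ge0 ?(ltW nr).
  rewrite !(cumZ (expR (- lam * n%:R)) _ lc) -mulrBr.
  apply: (@le_trans _ _ (expR (- lam * n%:R) * (K * expR (a * n.+1%:R)))).
    rewrite ler_wpM2l ?expR_ge0//.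
    have := Hc n.+1%:R (ler0n _ _).
    have : 0 <= cum c n%:R by apply: cum_ge0.
    lra.
  rewrite mulrCA -expRD -expRM_natl -mulrA -expRD.
  rewrite le_eqVlt; apply/orP; left; apply/eqP; congr (_ * expR _).
  by rewrite -natr1; ring.
move=> H.
have -> : K * expR a * (1 - expR (a - lam) ^+ n.+1) / (1 - expR (a - lam)) =
  K * expR a * (1 - expR (a - lam) ^+ n) / (1 - expR (a - lam)) +
  K * expR a * expR (a - lam) ^+ n.
  rewrite exprS; field; lra.
lra.
Qed.

Lemma weighted_cum c t : budget a K c ->
  cum (fun s => expR (- lam * s) * c s) t <= weighted_bound.
Proof.
move=> bc; have [_ g0 lg] := weight_profile bc.1.
have [n tn] : exists n : nat, t <= n%:R.
  by exists (Num.truncn t).+1; rewrite ltW// truncnS_gt.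
apply: (@le_trans _ _ (cum (fun s => expR (- lam * s) * c s) n%:R)).
  by apply: cum_nd => // s _; exact: g0.
apply: (le_trans (weighted_cum_nat n bc)).
rewrite /weighted_bound ler_wpM2r//.
  by rewrite invr_ge0 subr_ge0 (ltW decay_lt1).
have K0 := budget_ge0 bc.
rewrite ler_piMr ?mulr_ge0 ?expR_ge0// lerBlDr lerDl.
Qed.

(** The two summands come from the two terms of [felicity_le] integrated beyond [T]: e^(- eps t)
    gives e^(- eps T) / eps, and the weighted consumption is at most [weighted_bound]. *)
Definition tail (T : R) : R := M * (eps^-1 + weighted_bound) * expR (- eps * T).

(* Majorize u (c t) by the tangent of u at y = e^(lam t), where p y * y <= u y. *)
Lemma felicity_le c t : 0 <= c t -> 0 <= t ->
  felicity c t <= M * expR (- eps * t) * (1 + expR (- lam * t) * c t).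
Proof.
move=> c0 t0; have [_ u0 _ Hp HM] := Hu.
set y := expR (lam * t); have y0 : 0 < y := expR_gt0 _.
have [py Huy] := Hp y y0.
have uy : 0 <= u y by apply: util_ge0; exact: ltW.
have yp : p y * y <= u y by have := Huy 0 (lexx _); rewrite u0; lra.
have -> : expR (- lam * t) = y^-1 by rewrite mulNr expRN.
have uc : u (c t) <= u y * (1 + y^-1 * c t).
  apply: (le_trans (Huy _ c0)).
  have : p y * c t <= u y * (y^-1 * c t).
    rewrite mulrA ler_wpM2r// ler_pdivlMr//.
  have : 0 <= p y * y by rewrite mulr_ge0 ?ltW.
  lra.
apply: (@le_trans _ _ (expR (- rho * t) * u y * (1 + y^-1 * c t))).
  by rewrite /felicity -mulrA ler_wpM2l ?expR_ge0.
rewrite ler_wpM2r//.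
  by rewrite addr_ge0// mulr_ge0// invr_ge0 ltW.
have := HM t t0; rewrite -/y => h.
have e0 : 0 < expR (eps * t) := expR_gt0 _.
have -> : expR (- eps * t) = (expR (eps * t))^-1 by rewrite mulNr expRN.
by rewrite ler_pdivlMr// mulrC mulrA.
Qed.

Lemma felicity_tail c T S : budget a K c -> 0 <= T -> T <= S ->
  cum (felicity c) S - cum (felicity c) T <= tail T.
Proof.
move=> bc T0 TS; have [_ g0 lg] := weight_profile bc.1.
have [[mc c0 lc] _] := bc.
have lf := felicity_L1 bc.1.
have M0 := discount_bound_ge0.
pose g1 := fun t : R => M * expR (- eps * t).
pose g2 := fun t => M * expR (- eps * T) * (expR (- lam * t) * c t).
have l1 : L1_loc g1 by apply: L1_locZ; exact: L1_loc_exp.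
have l2 : L1_loc g2 by exact: L1_locZ.
apply: (@le_trans _ _ (cum (g1 \+ g2) S - cum (g1 \+ g2) T)).
  apply: cum_le_diff => //; first exact: L1_locD.
  move=> r /andP[Tr _].
  apply: (le_trans (felicity_le (c0 r) _)); first lra.
  rewrite mulrDr mulr1 /= lerD2l /g2 ler_wpM2r//.
  by rewrite ler_wpM2l// expR_decay_le ?(ltW eps0) ?(ltW Tr).
rewrite !cumD// /g1 /g2 !(cumZ M _ (L1_loc_exp _)) !(cumZ (M * _) _ lg).
have epsn0 : - eps != 0 by rewrite oppr_eq0 gt_eqF.
rewrite !cum_exp//; last exact: le_trans TS.
have := weighted_cum S bc.
have : 0 <= cum (fun s => expR (- lam * s) * c s) T by apply: cum_ge0.
set w1 := cum _ T; set w2 := cum _ S => h1 h2.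
have e1 : 0 <= expR (- eps * S) := expR_ge0 _.
have e2 : 0 <= expR (- eps * T) := expR_ge0 _.
have ei : (- eps)^-1 = - eps^-1 by rewrite invrN.
rewrite !ei.
rewrite /tail.
have : M * expR (- eps * T) * (w2 - w1) <= M * expR (- eps * T) * weighted_bound.
  by rewrite ler_wpM2l ?mulr_ge0//; lra.
have : M * (expR (- eps * S) / eps) >= 0 by rewrite !mulr_ge0// invr_ge0 ltW.
lra.
Qed.

Lemma tail_ge0 T : 0 <= K -> 0 <= tail T.
Proof.
move=> K0; rewrite /tail mulr_ge0 ?expR_ge0// mulr_ge0 ?discount_bound_ge0//.
rewrite addr_ge0 ?invr_ge0 ?(ltW eps0)//.
by rewrite /weighted_bound mulr_ge0 ?mulr_ge0 ?expR_ge0 ?invr_ge0 ?subr_ge0 ?(ltW decay_lt1).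
Qed.

Lemma tail_cvg0 e : 0 <= K -> 0 < e ->
  exists2 T0, 0 <= T0 & forall T, T0 <= T -> tail T <= e.
Proof.
move=> K0 e0; have := tail_ge0 0 K0; rewrite /tail mulr0 expR0 mulr1.
set A := M * _ => A0; have ep := eps0.
(* The threshold comes from e^(eps T) >= 1 + eps T: once A <= e eps T, the tail A e^(- eps T) is at
   most e. *)
exists (A / (e * eps)); first by rewrite divr_ge0// mulr_ge0 ?(ltW e0) ?(ltW ep).
move=> T; rewrite ler_pdivrMr ?mulr_gt0// => AT.
rewrite mulNr expRN ler_pdivrMr ?expR_gt0//.
apply: (@le_trans _ _ (e * (1 + eps * T))); first by rewrite mulrDr mulr1; lra.
by rewrite ler_pM2l// expR_ge1Dx.
Qed.

(** The default of [fine] at infinite values does not arise under a budget, where [total_utilityE]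
    gives finiteness. *)
Definition real_utility c := fine (total_utility u rho c).

Lemma total_utilityE c : budget a K c -> total_utility u rho c = (real_utility c)%:E /\
  forall T, 0 <= T -> cum (felicity c) T <= real_utility c <= cum (felicity c) T + tail T.
Proof.
move=> bc; have K0 := budget_ge0 bc.
have [[mc c0 lc] _] := bc.
have lf := felicity_L1 bc.1.
have mf := felicity_measurable mc c0.
have f0 t : 0 <= felicity c t by exact: felicity_ge0.
have cv : (fun n => (cum (felicity c) n%:R)%:E) @ \oo --> total_utility u rho c.
  have := @ge0_cvgn_integral R mu (felicity c) f0 mf.
  apply: cvg_trans; apply: near_eq_cvg; apply: nearW => n.
  rewrite /cum /Rintegral fineK//; apply: integrable_fin_num => //.
  exact: L1_loc_int.
have fin : total_utility u rho c \is a fin_num.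
  rewrite ge0_fin_numE; last first.
    by apply: integral_ge0 => t _; rewrite lee_fin; exact: f0.
  apply: (@le_lt_trans _ _ (tail 0)%:E); last exact: ltry.
  rewrite -(cvg_lim _ cv)//; apply: lime_le; first by apply/cvg_ex; eexists; exact: cv.
  apply: nearW => n; rewrite lee_fin.
  have := felicity_tail bc (lexx 0) (ler0n R n).
  by rewrite (@cum_le0 _ _ 0)// subr0.
have E : total_utility u rho c = (real_utility c)%:E by rewrite /real_utility fineK.
split => // T T0.
have cvr : (fun n => cum (felicity c) n%:R) @ \oo --> real_utility c.
  by have cv2 := cv; rewrite E in cv2; exact: (fine_cvg cv2).
have nT : \forall n \near \oo, T <= n%:R.
  near=> n; apply: (@le_trans _ _ (Num.truncn T).+1%:R).
    by rewrite ltW// truncnS_gt.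
  by rewrite ler_nat; near: n; exact: nbhs_infty_ge.
have cvn : cvgn (fun n => cum (felicity c) n%:R) by apply/cvg_ex; exists (real_utility c).
rewrite -(cvg_lim _ cvr)//; apply/andP; split.
  apply: limr_ge => //; apply: filterS nT => n nT.
  by apply: cum_nd => // s _; exact: f0.
apply: limr_le => //; apply: filterS nT => n nT.
by have := felicity_tail bc T0 nT; lra.
Unshelve. all: by end_near. Qed.

End tail.
End util.
End utility.

(** * Truncation of controls *)

Section truncation.
Context {R : realType}.
Notation mu := (@lebesgue_measure R).
Implicit Types (F f g h c k : R -> R) (t x y : R).

Lemma patch_ge0 f (P : set R) : (forall t, 0 <= f t) -> forall t, 0 <= (f \_ P) t.
Proof. by move=> f0 t; rewrite patchE; case: ifP. Qed.

Lemma patch_L1 f (P : set R) : measurable P -> measurable_fun setT f ->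
  (forall t, 0 <= f t) -> L1_loc f ->
  measurable_fun setT (f \_ P) /\ L1_loc (f \_ P).
Proof.
move=> mP mf f0 lf.
have m1 : measurable_fun setT (f \_ P).
  by apply/(measurable_restrictT f) => //; exact: measurable_funTS.
split=> //; apply: (L1_loc_le m1 _ lf) => t t0.
by rewrite patchE; case: ifP => _; rewrite ?normr0 ?ger0_norm.
Qed.

Lemma cum_restrict_Ny f (T S : R) : T <= S -> cum (f \_ `]-oo, T]) S = cum f T.
Proof.
move=> TS; rewrite /cum -Rintegral_mkcondr; congr Rintegral.
apply/seteqP; split => t /=; rewrite !in_itv/=; first by case=> /andP[-> _] ->.
by move=> /andP[t0 tT]; rewrite t0 tT (le_trans tT).
Qed.

Lemma cum_restrict_oc f (T T' S : R) : L1_loc f -> 0 <= T -> T <= T' -> T' <= S ->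
  cum (f \_ `]T, T']) S = cum f T' - cum f T.
Proof.
move=> lf T0 TT' TS; rewrite cum_split// /cum -Rintegral_mkcondr; congr Rintegral.
apply/seteqP; split => t /=; rewrite !in_itv/=; first by case.
move=> /andP[t0 tT]; rewrite t0 tT (le_trans tT)// andbT; split=> //.
by rewrite (le_trans T0)// ltW.
Qed.

Section truncating.
Variables (F : R -> R) (a b : R).
Hypothesis HF : growth_bound F a b.
Variables (u p : R -> R) (rho lam eps M : R).
Hypothesis Hu : utility_bounds u p rho lam eps M.
Hypothesis Hp0 : forall e, 0 < e -> exists2 N0, 0 < N0 & forall N, N0 <= N -> p N <= e.
Hypothesis rho0 : 0 < rho.
Hypothesis alam : a < lam.
Hypothesis eps0 : 0 < eps.
Variable k0 : R.
Hypothesis k00 : 0 <= k0.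

(** Under [growth_bound] and [0 <= k0], this is admissibility up to a change of the control on a
    null set and at negative times: see [subsolution_admissible] and [admissible_normalize]. *)
Definition feasible c := profile c /\ exists k, subsolution F k0 c k.

Lemma feasible_budget c : feasible c -> budget a (k0 + b) c.
Proof.
move=> [pc [k sk]]; split=> // t t0; have [_ c0 lc] := pc.
by have [] := subsolution_bound HF lc (fun t _ => c0 t) sk t0.
Qed.

(** The same [k] remains a subsolution, since lowering cumulative consumption raises the right-hand
    side of its inequality. *)
Lemma feasible_le c c' : feasible c -> profile c' ->
  (forall t, 0 <= t -> cum c' t <= cum c t) -> feasible c'.
Proof.
move=> [_ [k [mk k_ge0 bk Hk]]] pc' cc'; split=> //; exists k; split=> // t t0.
by apply: (le_trans (Hk t t0)); have := cc' t t0; lra.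
Qed.

Lemma a_gt0 : 0 < a. Proof. by case: HF => _ _ _ []. Qed.

Lemma growth_constant_ge0 : 0 <= k0 + b.
Proof. by case: HF => _ _ _ [_ b0] _; rewrite addr_ge0. Qed.

Lemma real_utility_bounds c T : budget a (k0 + b) c -> 0 <= T ->
  cum (felicity u rho c) T <= real_utility u rho c <=
  cum (felicity u rho c) T + tail lam eps M a (k0 + b) T.
Proof.
by move=> bc T0; have [_] := total_utilityE Hu rho0 a_gt0 alam eps0 bc; exact.
Qed.

Lemma real_utility_le c (r S0 : R) : budget a (k0 + b) c ->
  (forall S, S0 <= S -> 0 <= S -> cum (felicity u rho c) S <= r) -> real_utility u rho c <= r.
Proof.
move=> bc H; apply/ler_addgt0Pl => e e0.
have [T0 T00 HT] := tail_cvg0 Hu alam eps0 growth_constant_ge0 e0.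
have := HT (Num.max T0 S0); rewrite le_max lexx => /(_ isT) h1.
have h0 : 0 <= Num.max T0 S0 by rewrite le_max T00.
have := H (Num.max T0 S0); rewrite le_max lexx orbT => /(_ isT h0) h2.
have /andP[_] := real_utility_bounds bc h0; lra.
Qed.

Lemma supergradient_antitone x y : 0 < x -> x <= y -> p y <= p x.
Proof.
rewrite le_eqVlt => x0 /orP[/eqP->//|xy].
have [_ _ _ Hp _] := Hu.
have [_ /(_ y) h1] := Hp x x0; have [_ /(_ x) h2] := Hp y (lt_trans x0 xy).
have := h1 (ltW (lt_trans x0 xy)); have := h2 (ltW x0) => h3 h4.
have : (p y - p x) * (y - x) <= 0 by lra.
by rewrite pmulr_lle0 ?subr_gt0// subr_le0.
Qed.

(* Consumption above N on [0, T] is saved and spent at a constant rate on ]T, T+1]. *)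
Lemma truncation (T : R) : 0 <= T -> exists2 N0, 0 < N0 &
  forall N, N0 <= N -> forall c, feasible c -> exists c', [/\ feasible c',
    (forall t, t <= T -> c' t <= N), (forall t, t <= T -> c' t <= c t) &
    real_utility u rho c <= real_utility u rho c'].
Proof.
move=> T0; have K0 := growth_constant_ge0; have a0 := a_gt0; have rh0 := rho0.
have [u_nd u0 _ Hp _] := Hu.
(* [A] bounds the consumption accumulated up to [T + 1]; the added 1 keeps it positive when [k0 + b]
   is 0. *)
pose A := (k0 + b) * expR (a * (T + 1)) + 1.
have A1 : 1 <= A by rewrite lerDr mulr_ge0 ?expR_ge0.
have A3 : 0 < 3 * A by lra.
(* Spending m <= A more than c gains at least m * p (3A) * (1 - c / (2A)): this is
   negative for c > 2A, and concavity applies below 3A otherwise. Since c has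
   integral at most A, integrating leaves m * p (3A) / 2. *)
pose be := expR (- rho * (T + 1)) * p (3 * A).
have be0 : 0 < be by rewrite mulr_gt0 ?expR_gt0//; case: (Hp _ A3).
have be20 : 0 < be / 2 by rewrite divr_gt0.
(* Saving the amount [m] above [N] loses at most [p N * m], as the discount factor is at most 1. The
   bound [be / 2] matches the gain [m * be / 2] from spending it later. *)
have [N0 N00 HN0] := Hp0 be20.
exists N0 => // N /[dup] NN0 /HN0 pN c fc.
have Ngt0 : 0 < N by exact: lt_le_trans NN0.
have bc := feasible_budget fc.
have [[mc c_ge0 lc] Hc] := bc.
pose d t := c t - Num.min (c t) N.
have d_ge0 t : 0 <= d t by rewrite subr_ge0 ge_min lexx.
have md : measurable_fun setT d.
  by apply: measurable_funB => //; apply: measurable_minr => //; exact: measurable_cst.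
have dc t : d t <= c t.
  rewrite /d; have : 0 <= Num.min (c t) N by rewrite le_min c_ge0 ltW.
  lra.
have ld : L1_loc d.
  by apply: (L1_loc_le md _ lc) => t _; rewrite ger0_norm.
pose m := cum d T.
have m0 : 0 <= m by apply: cum_ge0.
have mA : m <= A.
  apply: (@le_trans _ _ (cum c T)); first by apply: cum_le.
  apply: (le_trans (Hc T T0)).
  rewrite /A -[leLHS]addr0; apply: lerD => //.
  by rewrite ler_wpM2l// ler_expR ler_pM2l//; lra.
pose P1 := `]-oo, T]%classic : set R.
pose P2 := `]T, T + 1]%classic : set R.
have mP1 : measurable P1 by exact: measurable_itv.
have mP2 : measurable P2 by exact: measurable_itv.
pose e1 := d \_ P1; pose e2 := (fun=> m) \_ P2.
have [me1 le1] : measurable_fun setT e1 /\ L1_loc e1 by exact: patch_L1.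
have [me2 le2] : measurable_fun setT e2 /\ L1_loc e2.
  by apply: patch_L1 => //; exact: L1_loc_cst.
pose c' := (c \- e1) \+ e2.
have e1E t : t <= T -> e1 t = d t by move=> tT; rewrite /e1 patchE mem_set// /P1/= in_itv.
have e1E' t : T < t -> e1 t = 0.
  by move=> tT; rewrite /e1 patchE memNset// /P1/= in_itv/= leNgt tT.
have e2E t : T < t -> t <= T + 1 -> e2 t = m.
  by move=> tT tT1; rewrite /e2 patchE mem_set// /P2/= in_itv/= tT.
have e2E' t : t <= T -> e2 t = 0.
  by move=> tT; rewrite /e2 patchE memNset// /P2/= in_itv/= ltNge tT.
have e2E'' t : T + 1 < t -> e2 t = 0.
  by move=> tT; rewrite /e2 patchE memNset// /P2/= in_itv/= (leNgt t) tT andbF.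
have c'1 t : t <= T -> c' t = Num.min (c t) N.
  by move=> tT; rewrite /c'/= e1E// e2E'// /d; lra.
have c'2 t : T < t -> t <= T + 1 -> c' t = c t + m.
  by move=> tT tT1; rewrite /c'/= e1E'// e2E// subr0.
have c'3 t : T + 1 < t -> c' t = c t.
  by move=> tT; rewrite /c'/= e1E' ?e2E''// ?subr0 ?addr0//; lra.
have pc' : profile c'.
  split.
  - by apply: measurable_funD => //; exact: measurable_funB.
  - move=> t; case: (leP t T) => [tT|tT]; first by rewrite c'1// le_min c_ge0 ltW.
    case: (leP t (T + 1)) => [tT1|tT1]; first by rewrite c'2// addr_ge0.
    by rewrite c'3.
  - by apply: L1_locD => //; exact: L1_locB.
have ce2 S : T + 1 <= S -> cum e2 S = m.
  move=> TS; rewrite /e2 cum_restrict_oc//; [|exact: L1_loc_cst|lra].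
  by rewrite !cum_cst//; lra.
have fc' : feasible c'.
  apply: (feasible_le fc) => // t t0.
  case: (leP t T) => [tT|tT].
    case: pc' => _ _ lc'; apply: cum_le => // s /andP[_ st].
    by rewrite c'1 ?ge_min ?lexx// (le_trans st).
  rewrite /c' cumD//; last exact: L1_locB.
  rewrite cumB// /e1 (cum_restrict_Ny _ (ltW tT)) -/m.
  have : cum e2 t <= m.
    have <- : cum e2 (Num.max t (T + 1)) = m by apply: ce2; rewrite le_max lexx orbT.
    apply: cum_nd => //; last by rewrite le_max lexx.
    by move=> s _; apply: patch_ge0.
  lra.
have bc' := feasible_budget fc'.
exists c'; split => //.
- by move=> t tT; rewrite c'1// ge_min lexx orbT.
- by move=> t tT; rewrite c'1// ge_min lexx.
(* Before [T + 1] the postponed consumption is not yet fully recovered, so partial utilities are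
   compared beyond [T + 1] only. *)
apply: (real_utility_le (S0 := T + 1) bc) => S TS S0.
apply: (@le_trans _ _ (cum (felicity u rho c') S)); last first.
  by have /andP[] := real_utility_bounds bc' S0.
have lh := felicity_L1 Hu rho0 bc.1; have lh' := felicity_L1 Hu rho0 bc'.1.
pose e3 := c \_ P2.
have [me3 le3] : measurable_fun setT e3 /\ L1_loc e3 by exact: patch_L1.
have ce3 : cum e3 S <= A.
  rewrite /e3 cum_restrict_oc//; last lra.
  have : 0 <= cum c T by exact: cum_ge0.
  have := Hc (T + 1); rewrite /A => h; have := h ltac:(lra); lra.
(* Loss, gain and correction are written as multiples of [e1], [e2] and [e3], supported on [0, T] or
   ]T, T+1], so that a single pointwise inequality is integrated over [0, S]. *)
have L1 : L1_loc (felicity u rho c \+ (fun t => be * e2 t)).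
  by apply: L1_locD => //; exact: L1_locZ.
have L2 : L1_loc ((felicity u rho c' \+ (fun t => p N * e1 t)) \+
                  (fun t => be * m / (2 * A) * e3 t)).
  by apply: L1_locD; [apply: L1_locD => //|]; exact: L1_locZ.
have := @cum_le _ _ _ S L1 L2 _.
rewrite cumD//; last exact: L1_locZ.
rewrite cumD//; [|by apply: L1_locD => //; exact: L1_locZ|exact: L1_locZ].
rewrite cumD//; last exact: L1_locZ.
rewrite (cumZ be _ le2) (cumZ (p N) _ le1) (cumZ (be * m / (2 * A)) _ le3).
have ce1 : cum e1 S = m by rewrite /e1 cum_restrict_Ny//; lra.
rewrite ce2// ce1 => H.
have h1 : p N * m <= be / 2 * m by rewrite ler_wpM2r.
have A20 : 0 < 2 * A by lra.
have bm0 : 0 <= be * m / (2 * A) by rewrite divr_ge0 ?(ltW A20)// mulr_ge0 ?(ltW be0).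
have h2 : be * m / (2 * A) * cum e3 S <= be * m / 2.
  apply: (@le_trans _ _ (be * m / (2 * A) * A)).
    by rewrite ler_wpM2l.
  by rewrite le_eqVlt; apply/orP; left; apply/eqP; field; lra.
suff : cum (felicity u rho c) S + be * m <=
  cum (felicity u rho c') S + p N * m + be * m / (2 * A) * cum e3 S by lra.
apply: H => t /andP[t0 tS] /=.
have ex1 : 0 <= expR (- rho * t) := expR_ge0 _.
case: (leP t T) => [tT|tT].
  rewrite e2E'// mulr0 addr0 e1E// /e3 patchE memNset ?mulr0 ?addr0; last first.
    by rewrite /P2/= in_itv/= ltNge tT.
  rewrite /felicity c'1//.
  have ex2 : expR (- rho * t) <= 1 by rewrite expR_decay_le1// ltW.
  have [pN0 HuN] := Hp N Ngt0.
  suff : u (c t) - u (Num.min (c t) N) <= p N * d t.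
    have : 0 <= p N * d t by rewrite mulr_ge0// ltW.
    nra.
  rewrite /d; case: (leP (c t) N) => [cN|cN]; first by rewrite !subrr mulr0.
  by have := HuN (c t) (c_ge0 t); lra.
rewrite e1E'// mulr0 addr0.
case: (leP t (T + 1)) => [tT1|tT1]; last first.
  by rewrite e2E''// mulr0 addr0 /felicity c'3// lerDl mulr_ge0// patch_ge0.
rewrite e2E// /e3 patchE mem_set; last by rewrite /P2/= in_itv/= tT.
rewrite /felicity c'2//.
have ex2 : expR (- rho * (T + 1)) <= expR (- rho * t).
  by rewrite expR_decay_le// ltW.
have ude : 0 <= u (c t + m) - u (c t) by rewrite subr_ge0; apply: u_nd => //; lra.
case: (leP (c t) (2 * A)) => [cA|cA].
  have H2 : m * p (3 * A) * (1 - c t / (2 * A)) <= u (c t + m) - u (c t).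
    have p3 : 0 < p (3 * A) by case: (Hp _ A3).
    apply: (@le_trans _ _ (m * p (3 * A))).
      rewrite ler_piMr ?mulr_ge0//; first exact: ltW.
      by rewrite lerBlDr lerDl divr_ge0//; lra.
    (* Tangents exist at positive points only; if [c t + m] is 0, then so is [m]. *)
    have [y0|y0] := ltP 0 (c t + m).
      have [_ /(_ (c t) (c_ge0 t))] := Hp _ y0.
      have : p (3 * A) <= p (c t + m) by apply: supergradient_antitone => //; lra.
      nra.
    have -> : m = 0 by have := c_ge0 t; lra.
    by rewrite mul0r addr0 subrr.
  have : expR (- rho * (T + 1)) * (m * p (3 * A) * (1 - c t / (2 * A))) <=
    expR (- rho * t) * (u (c t + m) - u (c t)).
    apply: (@le_trans _ _ (expR (- rho * (T + 1)) * (u (c t + m) - u (c t)))).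
      by rewrite ler_wpM2l ?expR_ge0.
    by rewrite ler_wpM2r.
  rewrite /be.
  have -> : expR (- rho * (T + 1)) * (m * p (3 * A) * (1 - c t / (2 * A))) =
   expR (- rho * (T + 1)) * p (3 * A) * m -
   expR (- rho * (T + 1)) * p (3 * A) * m / (2 * A) * c t by field; lra.
  lra.
have : be * m <= be * m / (2 * A) * c t.
  rewrite [leRHS]mulrAC ler_pdivlMr; last lra.
  by rewrite ler_wpM2l ?(ltW cA)// mulr_ge0 ?(ltW be0).
have : expR (- rho * t) * u (c t) <= expR (- rho * t) * u (c t + m).
  by rewrite ler_wpM2l//; lra.
lra.
Qed.

End truncating.
End truncation.

(** * Locally bounded maximizing sequences *)

Section maximizing_sequence.
Context {R : realType}.
Notation mu := (@lebesgue_measure R).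
Implicit Types (F f g h c k : R -> R) (t x y : R).

Section maximizing.
Variables (F : R -> R) (a b : R).
Hypothesis HF : growth_bound F a b.
Variables (u p : R -> R) (rho lam eps M : R).
Hypothesis Hu : utility_bounds u p rho lam eps M.
Hypothesis Hp0 : forall e, 0 < e -> exists2 N0, 0 < N0 & forall N, N0 <= N -> p N <= e.
Hypothesis rho0 : 0 < rho.
Hypothesis alam : a < lam.
Hypothesis eps0 : 0 < eps.
Variable k0 : R.
Hypothesis k00 : 0 <= k0.
Local Notation J := (real_utility u rho).
Local Notation feas := (feasible F k0).

Lemma feasible0 : feas (fun=> 0).
Proof.
split; first by split => //; exact: L1_loc_cst.
exists (fun=> 0); split => //; first by move=> T; exists 0.
move=> t t0; rewrite cum_cst// mul0r subr0.
rewrite (@eq_cum _ _ (fun=> 0)) ?cum_cst ?mul0r ?addr0// => s _ /=.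
by case: HF.
Qed.

(** Horizons are treated in increasing order. Truncating at one horizon does not raise consumption
    before it, so the bounds already obtained persist; what is postponed falls beyond it, where the
    later truncations act. *)
Lemma truncation_bounds : exists Ns : nat -> R,
  [/\ forall i, 0 < Ns i, {homo Ns : i j / (i <= j)%N >-> i <= j} &
    forall n c, feas c -> exists c', [/\ feas c',
      forall i t, (i < n)%N -> t <= i.+1%:R -> c' t <= Ns i & J c <= J c']].
Proof.
have /choice[N0 HN0] : forall i : nat, exists N0 : R, 0 < N0 /\
    forall N, N0 <= N -> forall c, feas c -> exists c', [/\ feas c',
    (forall t, t <= i.+1%:R -> c' t <= N), (forall t, t <= i.+1%:R -> c' t <= c t) &
    J c <= J c'].
  move=> i; have [N0 N00 H] := truncation HF Hu Hp0 rho0 alam eps0 k00 (ler0n R i.+1).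
  by exists N0.
(* Partial sums dominate each threshold and are nondecreasing in [i]. *)
pose Ns i := \sum_(j < i.+1) N0 j.
have N0_ge0 j : 0 <= N0 j by apply: ltW; case: (HN0 j).
have NsE i : N0 i <= Ns i.
  by rewrite /Ns big_ord_recr/= lerDr sumr_ge0.
exists Ns; split.
- by move=> i; apply: lt_le_trans (NsE i); case: (HN0 i).
- by apply: homo_leq => // [i j l|i]; [exact: le_trans|rewrite /Ns [leRHS]big_ord_recr/= lerDl].
elim=> [|n IH] c fc; first by exists c; split.
have [c1 [fc1 Hc1 Jc1]] := IH c fc.
have [_ /(_ _ (NsE n) _ fc1)[c2 [fc2 Hc2 c21 Jc2]]] := HN0 n.
exists c2; split => //; last exact: le_trans Jc2.
move=> i t; rewrite ltnS leq_eqVlt => /predU1P[->|it] tn; first exact: Hc2.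
apply: le_trans (Hc1 i t it tn); apply: c21.
by apply: (le_trans tn); rewrite ler_nat ltnS ltnW.
Qed.

Definition optimal_value := sup [set J c | c in feas].

Lemma real_utility_ub c : feas c -> J c <= tail lam eps M a (k0 + b) 0.
Proof.
move=> /(feasible_budget HF) bc.
have /andP[_] := real_utility_bounds HF Hu rho0 alam eps0 bc (lexx 0).
by rewrite cum_le0// add0r.
Qed.

Lemma has_sup_optimal_value : has_sup [set J c | c in feas].
Proof.
split; first by exists (J (fun=> 0)); exists (fun=> 0) => //; exact: feasible0.
by exists (tail lam eps M a (k0 + b) 0) => _ [c fc <-]; exact: real_utility_ub.
Qed.

Lemma real_utility_le_value c : feas c -> J c <= optimal_value.
Proof.
by move=> fc; apply: ub_le_sup; [case: has_sup_optimal_value|exists c].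
Qed.

(** Only finitely many truncations can be made, up to a horizon depending on [e]. Beyond it
    consumption is set to 0, which costs at most a tail, and the envelope [g] holds at all times
    without depending on [e]. *)
Lemma maximizing_bounded : exists2 g : R -> R,
  (forall t, 0 <= g t) /\ {homo g : s t / s <= t} &
  forall e, 0 < e -> exists c, [/\ feas c, forall t, c t <= g t & optimal_value - e <= J c].
Proof.
have [Ns [Ns0 Nsh HNs]] := truncation_bounds.
exists (fun t => Ns (Num.truncn t)).
  split=> [t|s t st]; first exact: ltW.
  by apply/Nsh/Num.Theory.le_truncn.
move=> e e0; have e20 : 0 < e / 2 by lra.
have [_ [c1 fc1 <-] Jc1] := sup_adherent e20 has_sup_optimal_value.
have [T0 T00 HT] := tail_cvg0 Hu alam eps0 (growth_constant_ge0 HF k00) e20.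
pose n := Num.truncn T0.
have Tn : T0 <= n.+1%:R by rewrite ltW// truncnS_gt.
have [c2 [fc2 Hc2 Jc2]] := HNs n.+1 c1 fc1.
pose c3 := c2 \_ `]-oo, n.+1%:R].
have [[mc2 c2_ge0 lc2] _] := fc2.
have [mc3 lc3] : measurable_fun setT c3 /\ L1_loc c3 by exact: patch_L1.
have c3_ge0 : forall t, 0 <= c3 t by exact: patch_ge0.
have c32 t : c3 t <= c2 t by rewrite /c3 patchE; case: ifP.
have fc3 : feas c3 by apply: (feasible_le fc2) => // t t0; exact: cum_le.
exists c3; split => //.
  move=> t; rewrite /c3 patchE; case: ifPn; last by move=> _; exact: ltW.
  rewrite inE/= in_itv/= => tn.
  have tt : t <= (Num.truncn t).+1%:R by rewrite ltW// truncnS_gt.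
  have [h|h] := ltnP (Num.truncn t) n.+1; first exact: Hc2.
  (* The remaining case is [t = n.+1], whose integer part is out of range: the bound of index [n]
     and monotonicity of [Ns] cover it. *)
  by apply: le_trans (Hc2 n t _ tn) _ => //; apply: Nsh; exact: ltnW.
have nn : 0 <= n.+1%:R :> R by [].
have /andP[_ h1] := real_utility_bounds HF Hu rho0 alam eps0 (feasible_budget HF fc2) nn.
have /andP[h2 _] := real_utility_bounds HF Hu rho0 alam eps0 (feasible_budget HF fc3) nn.
have h3 := HT _ Tn.
have h4 : cum (felicity u rho c3) n.+1%:R = cum (felicity u rho c2) n.+1%:R.
  apply: eq_cum => s /andP[_ sn]; rewrite /felicity /c3 patchE mem_set//.
rewrite /optimal_value; lra.
Qed.

(* Tychonoff's theorem on R^rat replaces a diagonal argument. *)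
Lemma extraction (d : nat -> R -> R) : (forall n, feas (d n)) ->
  exists (phi : nat -> nat) (l : rat -> R), (forall j, (j <= phi j)%N) /\
    forall q, cum (d (phi j)) (ratr q) @[j --> \oo] --> l q.
Proof.
move=> fd.
pose A (q : rat) : set R := `[0, (k0 + b) * expR (a * `|ratr q|)]%classic.
pose Phi (n : nat) : rat -> R := fun q => cum (d n) (ratr q).
have PhiA n q : A q (Phi n q).
  have [[_ c0 lc] Hc] := feasible_budget HF (fd n).
  rewrite /A/= in_itv/= cum_ge0//=; apply: (le_trans _ (Hc _ (normr_ge0 _))).
  by apply: cum_nd => //; exact: ler_norm.
have cA q : compact (A q) by exact: segment_compact.
have [|l [_ cl]] := @tychonoff rat (fun=> R) A cA (Phi @ \oo) _ _.
  by exists 0%N => // n _ q; exact: PhiA.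
(* The index [phi j] approximates the cluster point within 1/(j+1) at the rationals with code below
   [j]; these are finitely many coordinates, hence a neighbourhood in the product. *)
have /choice[phi Hphi] : forall j, exists n, (j <= n)%N /\
    forall i, (i < j)%N -> forall q, unpickle i = Some q ->
      `|Phi n q - l q| < j.+1%:R^-1.
  move=> j.
  have : nbhs l [set f | forall i, (i < j)%N -> forall q, unpickle i = Some q ->
      `|f q - l q| < j.+1%:R^-1].
    have e0 : 0 < j.+1%:R^-1 :> R by rewrite invr_gt0.
    elim: {1}j => [|m IH]; first by apply: filterS (@filterT _ (nbhs l) _) => f _ i.
    case E : (unpickle m) => [q|]; last first.
      apply: filterS IH => f Hf i; rewrite ltnS leq_eqVlt => /predU1P[->|im] q.
        by rewrite E.
      exact: Hf.
    have nq : nbhs l [set f : prod_topology (fun=> R) | `|f q - l q| < j.+1%:R^-1].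
      have nb : nbhs (l q) [set x : R | `|x - l q| < j.+1%:R^-1].
        by apply/nbhs_ballP; exists j.+1%:R^-1 => // x; rewrite /ball/= distrC.
      exact: (@proj_continuous rat (fun=> R) q l _ nb).
    apply: filterS2 IH nq => f Hf fq i; rewrite ltnS leq_eqVlt => /predU1P[->|im] q'.
      by rewrite E => -[<-].
    exact: Hf.
  have : (Phi @ \oo) [set Phi n | n in [set n | (j <= n)%N]].
    by exists j => // n /= jn; exists n.
  by move=> /cl/[apply] [[_ [[n jn <-] Hn]]]; exists n.
exists phi, l; split; first by move=> j; case: (Hphi j).
move=> q; apply/cvgrPdist_lt => e e0.
near=> j; rewrite distrC; have [_ /(_ (pickle q) _ q (pickleK q)) H] := Hphi j.
apply: lt_trans (H _) _; first by near: j; exact: nbhs_infty_gt.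
near: j; exact: near_infty_natSinv_lt (PosNum e0).
Unshelve. all: by end_near. Qed.

End maximizing.
End maximizing_sequence.

(** * Almost everywhere convergence of midpoint combinations *)

Section midpoint_hulls.
Context {R : realType}.
Notation mu := (@lebesgue_measure R).
Implicit Types (f g h c k : R -> R) (t x y : R).

Definition midpoint f g t : R := (f t + g t) / 2.

(** Dyadic convex combinations of the tail from [m] on. The inductive form reduces each stability
    property to its midpoint case, and midpoints are what the parallelogram identity involves. *)
Inductive hull (d : nat -> R -> R) (m : nat) : (R -> R) -> Prop :=
| hull_base n : (m <= n)%N -> hull d m (d n)
| hull_mid f g : hull d m f -> hull d m g -> hull d m (midpoint f g).

Lemma hull_le d m m' f : (m <= m')%N -> hull d m' f -> hull d m f.
Proof.
move=> mm; elim=> [n mn|f1 f2 _ H1 _ H2]; last exact: hull_mid.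
by apply: hull_base; exact: leq_trans mn.
Qed.

Lemma cvg_geometric_increments (v : nat -> R) (B : R) :
  (forall j, `|v j.+1 - v j| <= B * (2^-1) ^+ j) -> cvgn v.
Proof.
move=> Hv.
have B0 : 0 <= B by have := Hv 0%N; rewrite expr0 mulr1; apply: le_trans.
have : cvgn (series (telescope v)).
  apply: normed_cvg; apply: (@series_le_cvg _ _ (geometric B 2^-1)) => //.
  - by move=> n; rewrite /=.
  - by move=> n; rewrite /= mulr_ge0// exprn_ge0.
  - by apply: is_cvg_geometric_series; rewrite ger0_norm//; lra.
move=> /cvg_ex[l Hl]; apply/cvg_ex; exists (v 0%N + l).
have H2 : (fun n => v 0%N + series (telescope v) n) @ \oo --> v 0%N + l.
  by apply: cvgD => //; exact: cvg_cst.
have E : (fun n => v 0%N + series (telescope v) n) = v.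
  by apply/funext => n; rewrite [RHS]eq_sum_telescope.
by rewrite E in H2.
Qed.

Section komlos.
Variables (d : nat -> R -> R) (g : R -> R).
Hypothesis g_nd : {homo g : s t / s <= t}.
Hypothesis md : forall n, measurable_fun setT (d n).
Hypothesis d_bd : forall n t, 0 <= d n t <= g t.

Local Notation D := (`[0%R, +oo[%classic : set R).

Lemma hull_profile m f : hull d m f ->
  measurable_fun setT f /\ forall t, 0 <= f t <= g t.
Proof.
elim=> [n _|f1 f2 _ [m1 b1] _ [m2 b2]]; first by [].
split.
  by apply: measurable_funM; [exact: measurable_funD|exact: measurable_cst].
by move=> t; have := b1 t; have := b2 t; rewrite /midpoint; lra.
Qed.

Lemma envelope_ge0 t : 0 <= g t.
Proof. by have /andP[h1 h2] := d_bd 0 t; exact: le_trans h2. Qed.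

Lemma exp_integrable : mu.-integrable D (fun t => (expR (-1 * t))%:E).
Proof.
have mexp : measurable_fun setT (fun t : R => expR (-1 * t)).
  by apply: continuous_measurable_fun; exact: continuous_expRM.
apply/integrableP; split.
  by apply/measurable_EFinP; exact: measurable_funTS.
apply: (@le_lt_trans _ _ 1%:E); last exact: ltry.
have -> : (\int[mu]_(t in D) `|(expR (-1 * t))%:E| =
           \int[mu]_(t in D) (expR (-1 * t))%:E)%E.
  by apply: eq_integral => t _; rewrite /= ger0_norm ?expR_ge0.
have := @ge0_cvgn_integral R mu (fun t => expR (-1 * t)) (fun t => expR_ge0 _) mexp.
move=> cv; rewrite -(cvg_lim _ cv)//; apply: lime_le.
  by apply/cvg_ex; eexists; exact: cv.
apply: nearW => n.
have -> : (\int[mu]_(x in `[0%R, n%:R]) (expR (-1 * x))%:E)%E =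
    (cum (fun t => expR (-1 * t)) n%:R)%:E.
  rewrite /cum /Rintegral fineK//; apply: integrable_fin_num => //.
  by apply: L1_loc_int; exact: L1_loc_exp.
rewrite cum_exp ?oppr_eq0 ?oner_eq0// lee_fin invrN invr1 mulrN1 opprB.
by have := expR_ge0 (-1 * (n%:R : R)); lra.
Qed.

(* Makes the squares of all functions bounded by g integrable on [0, +oo[. *)
Definition weight t : R := expR (-1 * t) / (1 + g t) ^+ 2.

Lemma weight_gt0 t : 0 < weight t.
Proof. by rewrite divr_gt0 ?expR_gt0// exprn_gt0// ltr_wpDr// envelope_ge0. Qed.

Definition wsq f t : R := weight t * f t ^+ 2.

Lemma wsq_ge0 f t : 0 <= wsq f t.
Proof. by rewrite mulr_ge0 ?sqr_ge0// ltW// weight_gt0. Qed.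

Lemma wsq_measurable f : measurable_fun setT f -> measurable_fun setT (wsq f).
Proof.
move=> mf; apply: measurable_funM; last exact: measurable_funX.
apply: measurable_funM.
  by apply: continuous_measurable_fun; exact: continuous_expRM.
apply: nonincreasing_measurable => // x y xy.
rewrite lef_pV2 ?posrE ?exprn_gt0 ?ltr_wpDr ?envelope_ge0//.
by rewrite lerXn2r ?nnegrE ?addr_ge0 ?envelope_ge0// lerD2l; exact: g_nd.
Qed.

Lemma wsq_le f t : `|f t| <= g t -> wsq f t <= expR (-1 * t).
Proof.
move=> fg; rewrite /wsq /weight mulrAC ler_pdivrMr; last first.
  by rewrite exprn_gt0// ltr_wpDr// envelope_ge0.
rewrite ler_wpM2l ?expR_ge0// -real_normK ?num_real// lerXn2r ?nnegrE//.
  by rewrite addr_ge0// envelope_ge0.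
by apply: (le_trans fg); rewrite lerDr.
Qed.

Lemma wsq_integrable f : measurable_fun setT f -> (forall t, `|f t| <= g t) ->
  mu.-integrable D (EFin \o wsq f).
Proof.
move=> mf fg; apply: le_integrable exp_integrable => //.
  by apply/measurable_EFinP; apply: measurable_funTS; exact: wsq_measurable.
move=> t _; rewrite /= lee_fin ger0_norm ?wsq_ge0// ger0_norm ?expR_ge0//.
exact: wsq_le.
Qed.

Definition Phi f : R := (\int[mu]_(t in D) wsq f t)%R.

Lemma Phi_ge0 f : 0 <= Phi f.
Proof. by apply: Rintegral_ge0 => t _; exact: wsq_ge0. Qed.

Lemma Phi_ub f : measurable_fun setT f -> (forall t, `|f t| <= g t) ->
  Phi f <= (\int[mu]_(t in D) expR (-1 * t))%R.
Proof.
move=> mf fg; apply: le_Rintegral => //; first exact: wsq_integrable.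
  exact: exp_integrable.
by move=> t _; exact: wsq_le.
Qed.

Lemma normr_le_of_bounds f t : 0 <= f t <= g t -> `|f t| <= g t.
Proof. by move=> /andP[f0 fg]; rewrite ger0_norm. Qed.

Lemma parallelogram m f1 f2 : hull d m f1 -> hull d m f2 ->
  Phi (f1 \- f2) = 2 * Phi f1 + 2 * Phi f2 - 4 * Phi (midpoint f1 f2).
Proof.
move=> h1 h2; have [m1 b1] := hull_profile h1; have [m2 b2] := hull_profile h2.
have [m3 b3] := hull_profile (hull_mid h1 h2).
have i1 := wsq_integrable m1 (fun t => normr_le_of_bounds (b1 t)).
have i2 := wsq_integrable m2 (fun t => normr_le_of_bounds (b2 t)).
have i3 := wsq_integrable m3 (fun t => normr_le_of_bounds (b3 t)).
have iZ (r : R) f : mu.-integrable D (EFin \o wsq f) ->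
    mu.-integrable D (EFin \o (fun t => r * wsq f t)).
  move=> iff.
  have -> : EFin \o (fun t => r * wsq f t) = (fun t => r%:E * (EFin \o wsq f) t)%E.
    by apply/funext => t /=; rewrite EFinM.
  exact: integrableZl.
have i12 : mu.-integrable D (EFin \o (fun t => 2 * wsq f1 t + 2 * wsq f2 t)).
  by apply: (integrableD _ (iZ 2 _ i1) (iZ 2 _ i2)).
rewrite /Phi -!RintegralZl//.
rewrite -RintegralD//; [|exact: iZ..].
rewrite -RintegralB//; last exact: iZ.
apply: eq_Rintegral => t _; rewrite /wsq /midpoint /=.
by field.
Qed.

Definition hull_inf m : R := inf [set Phi f | f in hull d m].

Lemma hull_inf_le m f : hull d m f -> hull_inf m <= Phi f.
Proof.
move=> hf; apply: ge_inf; last by exists f.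
by exists 0 => _ [f' _ <-]; exact: Phi_ge0.
Qed.

Lemma hull_inf_adherent m e : 0 < e -> exists2 f, hull d m f & Phi f < hull_inf m + e.
Proof.
move=> e0; have [|_ [f hf <-] H] := @inf_adherent _ [set Phi f | f in hull d m] _ e0.
  split; last by exists 0 => _ [f' _ <-]; exact: Phi_ge0.
  by exists (Phi (d m)); exists (d m) => //; exact: hull_base.
by exists f.
Qed.

Lemma has_sup_hull_inf : has_sup (range hull_inf).
Proof.
split; first by exists (hull_inf 0); exists 0%N.
exists (\int[mu]_(t in D) expR (-1 * t))%R => _ [m _ <-].
have hm : hull d m (d m) by exact: hull_base.
apply: (le_trans (hull_inf_le hm)); apply: Phi_ub => // t.
by apply: normr_le_of_bounds; exact: d_bd.
Qed.

(** With [delta] the supremum of the tail infima, [f_ j] and [f_ j.+1] have [Phi] below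
    [delta + e j], while their midpoint lies in a hull where [Phi] is at least [delta - e j]. The
    parallelogram identity leaves at most [8 * e j], whence the division by 8 in [e]. *)
Lemma hull_cauchy : exists f_ : nat -> R -> R, (forall j, hull d j (f_ j)) /\
  forall j, Phi (f_ j \- f_ j.+1) <= (8^-1) ^+ j.
Proof.
pose delta := sup (range hull_inf).
have ub m : hull_inf m <= delta.
  by apply: ub_le_sup; [case: has_sup_hull_inf|exists m].
pose e j : R := (8^-1) ^+ j / 8.
have e0 j : 0 < e j by rewrite divr_gt0// exprn_gt0// invr_gt0.
have /choice[m_ Hm] : forall j, exists m, delta - e j < hull_inf m.
  by move=> j; have [_ [m _ <-] H] := sup_adherent (e0 j) has_sup_hull_inf; exists m.
(* The sum makes [M_] nondecreasing and at least [m_ j]; adding [j] puts [f_ j] in the hull of the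
   tail from [j]. *)
pose M_ j := (\sum_(i < j.+1) m_ i + j)%N.
have mM j : (m_ j <= M_ j)%N by rewrite /M_ big_ord_recr/= -addnA addnCA leq_addr.
have MS j : (M_ j <= M_ j.+1)%N.
  by rewrite /M_ [in leqRHS]big_ord_recr/= -addnA leq_add2l (leq_trans (leqnSn j))// leq_addl.
have /choice[f_ Hf] : forall j, exists f, hull d (M_ j) f /\ Phi f < delta + e j.
  move=> j; have [f hf H] := hull_inf_adherent (M_ j) (e0 j).
  by exists f; split => //; apply: lt_le_trans H _; rewrite lerD2r.
exists f_; split => [j|j].
  by have [+ _] := Hf j; apply: hull_le; rewrite leq_addl.
have [h1 p1] := Hf j; have [h2 p2] := Hf j.+1.
have h1' := hull_le (mM j) h1.
have h2' := hull_le (leq_trans (mM j) (MS j)) h2.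
rewrite (parallelogram h1' h2').
have := hull_inf_le (hull_mid h1' h2'); have := Hm j.
have : e j.+1 <= e j.
  rewrite /e ler_pM2r ?invr_gt0// exprS ler_piMl ?exprn_ge0 ?invr_ge0//.
  by rewrite invf_le1//; lra.
have : 8 * e j = (8^-1) ^+ j by rewrite /e; field.
lra.
Qed.

(** As 4^j 8^(-j) = 2^(-j), the series with weights 4^j still has a finite integral, hence is finite
    almost everywhere. The factor 4^j is the square of the rate 2^j wanted for pointwise
    convergence. *)
Lemma wsq_series_finite (f_ : nat -> R -> R) :
  (forall j, hull d j (f_ j)) -> (forall j, Phi (f_ j \- f_ j.+1) <= (8^-1) ^+ j) ->
  {ae mu, forall t : R, 0 <= t -> exists C, forall j, 4 ^+ j * wsq (f_ j \- f_ j.+1) t <= C}.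
Proof.
move=> hf Pf.
pose q j t := 4 ^+ j * wsq (f_ j \- f_ j.+1) t.
have q0 j t : 0 <= q j t by rewrite mulr_ge0 ?exprn_ge0 ?wsq_ge0.
have mw j : measurable_fun setT (wsq (f_ j \- f_ j.+1)).
  apply: wsq_measurable; apply: measurable_funB.
    by case: (hull_profile (hf j)).
  by case: (hull_profile (hf j.+1)).
have mq j : measurable_fun setT (q j).
  by apply: measurable_funM => //; exact: measurable_cst.
have mqD j : measurable_fun D (fun t => (q j t)%:E).
  by apply/measurable_EFinP; exact: measurable_funTS.
have iw j : mu.-integrable D (EFin \o wsq (f_ j \- f_ j.+1)).
  have [m1 b1] := hull_profile (hf j); have [m2 b2] := hull_profile (hf j.+1).
  apply: wsq_integrable; first exact: measurable_funB.
  by move=> t; have := b1 t; have := b2 t; rewrite ler_norml /=; lra.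
have Iq j : (\int[mu]_(t in D) (q j t)%:E <= ((2^-1) ^+ j)%:E)%E.
  under eq_integral do rewrite EFinM.
  rewrite integralZl//; last exact: iw.
  have -> : (\int[mu]_(t in D) (wsq (f_ j \- f_ j.+1) t)%:E)%E = (Phi (f_ j \- f_ j.+1))%:E.
    by rewrite /Phi /Rintegral fineK//; exact: integrable_fin_num (iw j).
  rewrite -EFinM lee_fin.
  have -> : (2^-1) ^+ j = 4 ^+ j * (8^-1) ^+ j :> R.
    by rewrite -exprMn; congr (_ ^+ _); field.
  by rewrite ler_pM2l ?exprn_gt0.
have mS : measurable_fun D (fun t => \sum_(0 <= j <oo) (q j t)%:E)%E.
  apply: ge0_emeasurable_sum => [i x _ _|i _]; first by rewrite lee_fin.
  exact: mqD.
have iS : mu.-integrable D (fun t => \sum_(0 <= j <oo) (q j t)%:E)%E.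
  apply/integrableP; split => //.
  apply: (@le_lt_trans _ _ 2%:E); last exact: ltry.
  have -> : (\int[mu]_(t in D) `|\sum_(0 <= j <oo) (q j t)%:E| =
             \int[mu]_(t in D) (\sum_(0 <= j <oo) (q j t)%:E))%E.
    apply: eq_integral => t _.
    by rewrite gee0_abs// nneseries_ge0// => i _ _; rewrite lee_fin.
  rewrite integral_nneseries//; last by move=> i t _; rewrite lee_fin.
  apply: lime_le.
    by apply: is_cvg_nneseries => i _ _; apply: integral_ge0 => t _; rewrite lee_fin.
  apply: nearW => n.
  apply: (@le_trans _ _ (\sum_(0 <= j < n) ((2^-1) ^+ j)%:E)%E).
    by apply: lee_sum => i _; exact: Iq.
  rewrite sumEFin lee_fin.
  have -> : \sum_(0 <= j < n) (2^-1) ^+ j = series (geometric 1 2^-1) n :> R.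
    by rewrite /series /geometric /=; apply: eq_bigr => i _; rewrite mul1r.
  rewrite geometric_seriesE ?lt_eqF//=; last lra.
  rewrite ler_pdivrMr; last lra.
  have : 0 <= (2^-1) ^+ n :> R by rewrite exprn_ge0.
  lra.
have : {ae mu, forall t, D t -> (\sum_(0 <= j <oo) (q j t)%:E)%E \is a fin_num}.
  by apply: integrable_ae iS.
apply: filterS; first exact: (ae_filter_ringOfSetsType mu).
move=> t + t0; rewrite /= in_itv/= t0 => /(_ isT) fin.
exists (fine (\sum_(0 <= j <oo) (q j t)%:E)%E) => j.
rewrite -lee_fin fineK//.
apply: (le_trans _ (@nneseries_lim_ge _ (fun j => (q j t)%:E) xpredT 0 j.+1 _)).
  rewrite big_nat_recr//= leeDr// sume_ge0// => i _; rewrite lee_fin; exact: q0.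
by move=> i _ _; rewrite lee_fin.
Qed.

(** Taking the limsup as limit function makes measurability and the bounds hold at every point,
    including those where the sequence diverges. *)
Lemma hull_ae_cvg : exists (f_ : nat -> R -> R) (c : R -> R),
  [/\ (forall j, hull d j (f_ j)), measurable_fun setT c, (forall t, 0 <= c t <= g t) &
    {ae mu, forall t : R, 0 <= t -> f_ j t @[j --> \oo] --> c t}].
Proof.
have [f_ [hf Pf]] := hull_cauchy.
have fb j t : 0 <= f_ j t <= g t by have [_] := hull_profile (hf j); exact.
have ubf t : has_ubound (range (f_ ^~ t)).
  by exists (g t) => _ [j _ <-]; have /andP[] := fb j t.
have lbf t : has_lbound (range (f_ ^~ t)).
  by exists 0 => _ [j _ <-]; have /andP[] := fb j t.
exists f_, (fun t => limn_sup (f_ ^~ t)); split => //.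
- apply: measurable_fun_limn_sup => //.
  by move=> n; case: (hull_profile (hf n)).
- move=> t; have cv : cvgn (sups (f_ ^~ t)).
    by apply/cvg_ex; eexists; exact: cvg_sups_inf.
  apply/andP; split.
    apply: limr_ge => //; apply: nearW => n.
    have /andP[h _] := fb n t; apply: (le_trans h).
    by apply: ub_le_sup; [exact: has_ubound_sdrop|exists n => /=].
  apply: limr_le => //; apply: nearW => n.
  by apply: ge_sup; [exists (f_ n t), n => /=|move=> _ [j _ <-]; have /andP[] := fb j t].
have := wsq_series_finite hf Pf.
apply: filterS; first exact: (ae_filter_ringOfSetsType mu).
move=> t H t0; have [C HC] := H t0.
have w0 := weight_gt0 t.
have cv : cvgn (f_ ^~ t).
  apply: (@cvg_geometric_increments _ (Num.sqrt (C / weight t))) => j.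
  have C0 : 0 <= C by apply: le_trans (HC 0%N); rewrite mulr_ge0 ?exprn_ge0 ?wsq_ge0.
  have p0 : 0 <= (2^-1) ^+ j :> R by rewrite exprn_ge0.
  have s0 : 0 <= Num.sqrt (C / weight t) := sqrtr_ge0 _.
  rewrite -ler_sqr ?nnegrE ?mulr_ge0// real_normK ?num_real// exprMn sqr_sqrtr; last first.
    by rewrite divr_ge0 ?(ltW w0).
  have -> : ((2^-1) ^+ j) ^+ 2 = (4 ^+ j)^-1 :> R.
    by rewrite -exprM mulnC exprM -exprVn; congr (_ ^+ _); field.
  rewrite ler_pdivlMr ?exprn_gt0// ler_pdivlMr//.
  have -> : (f_ j.+1 t - f_ j t) ^+ 2 * 4 ^+ j * weight t = 4 ^+ j * wsq (f_ j \- f_ j.+1) t.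
    by rewrite /wsq /=; ring.
  exact: HC.
by rewrite cvg_limn_supE//; exact: cv.
Qed.

End komlos.
End midpoint_hulls.

(** * Passage to the limit *)

Section existence.
Context {R : realType}.
Notation mu := (@lebesgue_measure R).
Implicit Types (F f g h c k : R -> R) (t x y : R).

Lemma limn_sup_bounds (v : nat -> R) (A B : R) : (forall n, A <= v n <= B) ->
  [/\ sups v n @[n --> \oo] --> limn_sup v, A <= limn_sup v,
      (forall n, limn_sup v <= sups v n) & forall n, sups v n <= B].
Proof.
move=> Hv.
have ubv : has_ubound (range v) by exists B => _ [j _ <-]; have /andP[] := Hv j.
have lbv : has_lbound (range v) by exists A => _ [j _ <-]; have /andP[] := Hv j.
have cv : cvgn (sups v) by apply/cvg_ex; eexists; exact: cvg_sups_inf.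
have nd : nonincreasing_seq (sups v) by exact: nonincreasing_sups.
split => //.
- apply: limr_ge => //; apply: nearW => n.
  have /andP[h _] := Hv n; apply: (le_trans h).
  by apply: ub_le_sup; [exact: has_ubound_sdrop|exists n => /=].
- by move=> n; exact: (nonincreasing_cvgn_ge nd cv).
- move=> n; apply: ge_sup; first by exists (v n), n => /=.
  by move=> _ [j _ <-]; have /andP[] := Hv j.
Qed.

Section limit.
Variables (F : R -> R) (a b : R).
Hypothesis HF : growth_bound F a b.
Variable k0 : R.
Hypothesis k00 : 0 <= k0.
Local Notation feas := (feasible F k0).

(** For n >= m large, monotonicity of [F] bounds the n-th subsolution by the right-hand side written
    with the supremum over the tail from m. The supremum over n, then m tending to infinity under
    dominated convergence, gives the inequality for the limsup. Consumption enters with a minus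
    sign, so a lower bound on its running integrals suffices. *)
Lemma subsolution_limit (d : nat -> R -> R) c : (forall n, feas (d n)) -> profile c ->
  (forall t e, 0 <= t -> 0 < e ->
    exists n0, forall n, (n0 <= n)%N -> cum c t - e <= cum (d n) t) ->
  feas c.
Proof.
move=> fd pc Hc; split=> //.
have [cF ndF F0 [a0 b0] _] := HF.
have /choice[k_ Hk] := fun n => (fd n).2.
pose E (t : R) := (k0 + b) * expR (a * t).
have K0 : 0 <= k0 + b by rewrite addr_ge0.
have E0 t : 0 <= E t by rewrite mulr_ge0 ?expR_ge0.
have E_nd s t : s <= t -> E s <= E t.
  by move=> st; rewrite ler_wpM2l// ler_expR ler_pM2l.
pose kk n := k_ n \_ `[0, +oo[.
have kkE n t : 0 <= t -> kk n t = k_ n t.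
  by move=> t0; rewrite /kk patchE mem_set//= in_itv/= t0.
have kkB n t : 0 <= kk n t <= E t.
  rewrite /kk patchE; case: ifPn => [|_]; last by rewrite lexx E0.
  rewrite inE/= in_itv/= andbT => t0.
  have [[_ c0 lc] _] := fd n; have [_ k_ge0 _ _] := Hk n.
  rewrite k_ge0//=; have [h _] := subsolution_bound HF lc (fun t _ => c0 t) (Hk n) t0.
  by rewrite /E; lra.
have mkk n : measurable_fun setT (kk n).
  apply/(measurable_restrictT (k_ n)) => //; apply: measurable_funTS.
  by case: (Hk n).
have Hkk n t : 0 <= t -> kk n t <= k0 + cum (F \o kk n) t - cum (d n) t.
  move=> t0; rewrite kkE//; have [_ _ _ /(_ t t0)] := Hk n.
  by rewrite (@eq_cum _ (F \o kk n) (F \o k_ n))// => s /andP[s0 _] /=; rewrite kkE.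
pose kap t := limn_sup (kk ^~ t); pose kapm m t := sups (kk ^~ t) m.
have bnd t := limn_sup_bounds (fun n => kkB n t).
have ubk t : has_ubound (range (kk ^~ t)).
  by exists (E t) => _ [j _ <-]; have /andP[] := kkB j t.
have lbk t : has_lbound (range (kk ^~ t)).
  by exists 0 => _ [j _ <-]; have /andP[] := kkB j t.
have mkap : measurable_fun setT kap by exact: measurable_fun_limn_sup.
have mkapm m : measurable_fun setT (kapm m) by exact: measurable_fun_sups.
have kap0 t : 0 <= kap t by case: (bnd t).
have kap_le m t : kap t <= kapm m t by case: (bnd t) => _ _ h _; exact: h.
have kapm_le m t : kapm m t <= E t by case: (bnd t) => _ _ _ h; exact: h.
have kapm0 m t : 0 <= kapm m t by exact: le_trans (kap_le m t).
have locE k : (forall t, k t <= E t) -> forall T, exists M, forall t, 0 <= t <= T -> k t <= M.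
  by move=> kE T; exists (E T) => t /andP[_ tT]; apply: le_trans (kE t) (E_nd _ _ tT).
have kapE t : kap t <= E t by exact: le_trans (kap_le 0%N t) (kapm_le 0%N t).
have lFm m : L1_loc (F \o kapm m).
  by apply: (L1_loc_compF HF) => //; exact: locE.
exists kap; split => //; first exact: locE.
move=> t t0; apply/ler_addgt0Pl => e e0.
have [n0 Hn0] := Hc t e t0 e0.
have cv : (fun m => k0 + cum (F \o kapm m) t - cum c t + e) @ \oo -->
    k0 + cum (F \o kap) t - cum c t + e.
  apply: cvgD; last exact: cvg_cst.
  apply: cvgB; last exact: cvg_cst.
  apply: cvgD; first exact: cvg_cst.
  apply: (@cum_dominated _ _ _ (F (E t))).
  - move=> n; apply: measurable_funTS; apply: measurableT_comp => //.
    exact: production_measurable HF.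
  - apply: measurable_funTS; apply: measurableT_comp => //.
    exact: production_measurable HF.
  - apply: aeW => s _; apply: continuous_cvg; first exact: cF.
    by case: (bnd s).
  - move=> n s /andP[s0 st] /=; rewrite ger0_norm; last exact: (production_ge0 HF).
    by apply: ndF; apply: (le_trans (kapm_le n s)); exact: E_nd.
suff : kap t <= k0 + cum (F \o kap) t - cum c t + e by lra.
rewrite -(cvg_lim _ cv)//; apply: limr_ge; first by apply/cvg_ex; eexists; exact: cv.
near=> m; have n0m : (n0 <= m)%N by near: m; exact: nbhs_infty_ge.
apply: (le_trans (kap_le m t)); apply: ge_sup; first by exists (kk m t), m => /=.
move=> _ [n /= mn <-]; apply: (le_trans (Hkk n t t0)).
have := Hn0 n (leq_trans n0m mn).
have : cum (F \o kk n) t <= cum (F \o kapm m) t.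
  apply: cum_le => //.
    by apply: (L1_loc_compF HF) => //; [move=> s _; have /andP[] := kkB n s
       |apply: locE => s; have /andP[] := kkB n s].
  move=> s _ /=; apply: ndF; apply: ub_le_sup; first exact: has_ubound_sdrop.
  by exists n.
lra.
Unshelve. all: by end_near. Qed.

Variables (u p : R -> R) (rho lam eps M : R).
Hypothesis Hu : utility_bounds u p rho lam eps M.
Hypothesis Hp0 : forall e, 0 < e -> exists2 N0, 0 < N0 & forall N, N0 <= N -> p N <= e.
Hypothesis rho0 : 0 < rho.
Hypothesis alam : a < lam.
Hypothesis eps0 : 0 < eps.
Local Notation J := (real_utility u rho).
Local Notation K := (k0 + b).

(** Sum of the two tangent inequalities at the midpoint; a midpoint equal to 0 forces
    [x = y = 0]. *)
Lemma util_midpoint x y : 0 <= x -> 0 <= y -> u x + u y <= 2 * u ((x + y) / 2).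
Proof.
move=> x0 y0; have [_ u0 _ Hp _] := Hu.
have [z0|z0] := ltP 0 ((x + y) / 2).
  have [_ H] := Hp _ z0; have := H x x0; have := H y y0.
  have : p ((x + y) / 2) * (x - (x + y) / 2) + p ((x + y) / 2) * (y - (x + y) / 2) = 0.
    by field.
  lra.
have -> : x = 0 by lra. have -> : y = 0 by lra.
by rewrite addr0 mul0r u0; lra.
Qed.

Lemma midpoint_budget f1 f2 : budget a K f1 -> budget a K f2 -> budget a K (midpoint f1 f2).
Proof.
move=> [[m1 p1 l1] b1] [[m2 p2 l2] b2].
have E : midpoint f1 f2 = (fun t => 2^-1 * (f1 \+ f2) t).
  by apply/funext => t; rewrite /midpoint mulrC.
have l12 : L1_loc (f1 \+ f2) by exact: L1_locD.
split; first split.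
- by apply: measurable_funM; [exact: measurable_funD|exact: measurable_cst].
- by move=> t; rewrite divr_ge0 ?addr_ge0.
- by rewrite E; exact: L1_locZ.
move=> t t0; rewrite E cumZ// cumD//.
by have := b1 t t0; have := b2 t t0; lra.
Qed.

Lemma midpoint_cum f1 f2 t : L1_loc f1 -> L1_loc f2 ->
  cum (midpoint f1 f2) t = (cum f1 t + cum f2 t) / 2.
Proof.
move=> l1 l2; have -> : midpoint f1 f2 = (fun t => 2^-1 * (f1 \+ f2) t).
  by apply/funext => s; rewrite /midpoint mulrC.
by rewrite cumZ ?cumD 1?mulrC//; exact: L1_locD.
Qed.

Lemma hull_budget d m f : (forall n, budget a K (d n)) -> hull d m f -> budget a K f.
Proof.
by move=> bd; elim=> [n _|f1 f2 _ H1 _ H2]; [exact: bd|exact: midpoint_budget].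
Qed.

Lemma real_utility_midpoint f1 f2 : budget a K f1 -> budget a K f2 ->
  J f1 + J f2 <= 2 * J (midpoint f1 f2).
Proof.
move=> b1 b2; have b3 := midpoint_budget b1 b2.
apply/ler_addgt0Pl => e e0; have e20 : 0 < e / 2 by rewrite divr_gt0.
have [T0 T00 HT] := tail_cvg0 Hu alam eps0 (growth_constant_ge0 HF k00) e20.
have := HT _ (lexx T0).
have /andP[_ h1] := real_utility_bounds HF Hu rho0 alam eps0 b1 T00.
have /andP[_ h2] := real_utility_bounds HF Hu rho0 alam eps0 b2 T00.
have /andP[h3 _] := real_utility_bounds HF Hu rho0 alam eps0 b3 T00.
have l1 := felicity_L1 Hu rho0 b1.1; have l2 := felicity_L1 Hu rho0 b2.1.
have l3 := felicity_L1 Hu rho0 b3.1.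
have : cum (felicity u rho f1 \+ felicity u rho f2) T0 <=
    cum (fun t => 2 * felicity u rho (midpoint f1 f2) t) T0.
  apply: cum_le; [exact: L1_locD|exact: L1_locZ|].
  move=> t _; rewrite /felicity /= -mulrDr mulrCA ler_wpM2l ?expR_ge0//.
  by apply: util_midpoint; [case: b1 => -[]|case: b2 => -[]].
rewrite cumD// cumZ//; lra.
Qed.

Lemma hull_real_utility d m f v : (forall n, budget a K (d n)) ->
  (forall n, (m <= n)%N -> v <= J (d n)) -> hull d m f -> v <= J f.
Proof.
move=> bd Hv; elim=> [n mn|f1 f2 h1 H1 h2 H2]; first exact: Hv.
have := real_utility_midpoint (hull_budget bd h1) (hull_budget bd h2); lra.
Qed.

Lemma hull_cum d m f t l e : (forall n, budget a K (d n)) ->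
  (forall n, (m <= n)%N -> `|cum (d n) t - l| <= e) -> hull d m f ->
  `|cum f t - l| <= e.
Proof.
move=> bd Hv; elim=> [n mn|f1 f2 h1 H1 h2 H2]; first exact: Hv.
have [[_ _ l1] _] := hull_budget bd h1; have [[_ _ l2] _] := hull_budget bd h2.
rewrite midpoint_cum//; move: H1 H2; rewrite !ler_norml; lra.
Qed.

Lemma exists_optimal : exists (g c : R -> R),
  [/\ {homo g : s t / s <= t}, feas c, (forall t, 0 <= c t <= g t) &
      optimal_value F u rho k0 <= J c].
Proof.
have [g [g0 g_nd] Hmax] := maximizing_bounded HF Hu Hp0 rho0 alam eps0 k00.
set V := optimal_value F u rho k0 in Hmax *.
have /choice[d0 Hd0] : forall n : nat, exists c, [/\ feas c, forall t, c t <= g t &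
    V - n.+1%:R^-1 <= J c].
  by move=> n; apply: Hmax; rewrite invr_gt0.
have fd0 n : feas (d0 n) by case: (Hd0 n).
have [phi [l [phi_ge Hl]]] := extraction HF fd0.
pose d j := d0 (phi j).
have fd j : feas (d j) by case: (Hd0 (phi j)).
have dg j t : 0 <= d j t <= g t.
  case: (Hd0 (phi j)) => -[[_ c0 _] _] cg _; rewrite /d c0 cg//.
have Jd j : V - j.+1%:R^-1 <= J (d j).
  have [_ _] := Hd0 (phi j); apply: le_trans; rewrite lerD2l lerN2.
  by rewrite lef_pV2 ?posrE// ler_nat ltnS.
have bd j : budget a K (d j) by exact: feasible_budget (fd j).
have md j : measurable_fun setT (d j) by case: (bd j) => -[].
have [f_ [c [hf mc cg cvf]]] := hull_ae_cvg g_nd md dg.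
have fg j t : 0 <= f_ j t <= g t by have [_] := hull_profile md dg (hf j); exact.
have bf j := hull_budget bd (hf j).
have lc : L1_loc c.
  apply: L1_loc_bounded => [T _|T _]; first exact: measurable_funTS.
  exists (g T) => t /andP[_ tT]; have /andP[c0 ct] := cg t.
  by rewrite ger0_norm//; apply: (le_trans ct); exact: g_nd.
have pc : profile c by split => // t; have /andP[] := cg t.
have cvc t : cum (f_ j) t @[j --> \oo] --> cum c t.
  apply: (@cum_dominated _ _ _ (g t)).
  - by move=> n; apply: measurable_funTS; case: (bf n) => -[].
  - exact: measurable_funTS.
  - move: cvf; apply: filterS; first exact: (ae_filter_ringOfSetsType mu).
    by move=> s H /andP[s0 _]; exact: H.
  - move=> n s /andP[_ st]; have /andP[h1 h2] := fg n s.
    by rewrite ger0_norm// (le_trans h2)// g_nd.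
(* Running integrals of the tail lie in a small interval around [l q]; so do those of its midpoint
   combinations, by convexity of the interval. *)
have cl q : cum c (ratr q) = l q.
  apply: (cvg_unique _ (cvc (ratr q))) => //.
  apply/cvgrPdist_le => e e0.
  have /cvgrPdist_le/(_ _ e0)[j0 _ Hj0] := Hl q.
  exists j0 => // j /= jj; rewrite distrC.
  apply: (hull_cum bd _ (hf j)) => n jn; rewrite distrC.
  by apply: Hj0; exact: leq_trans jn.
(* Passage from rational to real times: running integrals of the [d n] are nondecreasing, and that
   of [c] has slope at most [g t] on [0, t], so a rational just below [t] loses at most [e / 2]. *)
have low t e : 0 <= t -> 0 < e ->
    exists n0, forall n, (n0 <= n)%N -> cum c t - e <= cum (d n) t.
  move=> t0 e0; have dl n := let: conj (And3 _ _ h) _ := bd n in h.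
  have d_ge0 n s : 0 <= d n s by have /andP[] := dg n s.
  move: t0; rewrite le_eqVlt => /orP[/eqP<-|t0].
    by exists 0%N => n _; rewrite !cum_le0//; lra.
  have G0 : 0 < g t + 1 by rewrite ltr_wpDl.
  pose del := e / (2 * (g t + 1)).
  have del0 : 0 < del by rewrite divr_gt0// mulr_gt0.
  have [q] : exists q : rat, ratr q \in `]Num.max 0 (t - del), t[.
    by apply: rat_in_itvoo; rewrite gt_max t0/=; lra.
  rewrite in_itv/= gt_max => /andP[/andP[q0 qd] qt].
  have e20 : 0 < e / 2 by rewrite divr_gt0.
  have /cvgrPdist_le/(_ _ e20)[n0 _ Hn0] := Hl q.
  exists n0 => n nn.
  have h1 : cum (d n) (ratr q) <= cum (d n) t by apply: cum_nd => //; exact: ltW.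
  have := Hn0 n nn; rewrite -/(d n) -cl ler_norml => /andP[_ h2].
  have h3 : cum c t - cum c (ratr q) <= cum (fun=> g t) t - cum (fun=> g t) (ratr q).
    apply: cum_le_diff => //; [exact: L1_loc_cst|exact: ltW|exact: ltW|].
    move=> r /andP[_ rt]; have /andP[_ h] := cg r; apply: (le_trans h); exact: g_nd.
  move: h3; rewrite !cum_cst ?(ltW q0) ?(ltW t0)// => h3.
  have h4 : (g t + 1) * del = e / 2 by rewrite /del; field; lra.
  have h5 : g t * t - g t * ratr q <= (g t + 1) * del.
    rewrite -mulrBr; apply: ler_pM => //; [by lra|by lra|by lra].
  lra.
have fc : feas c by exact: (subsolution_limit fd pc low).
exists g, c; split => //.
apply/ler_addgt0Pl => e e0.
have [T0 T00 HT] := tail_cvg0 Hu alam eps0 (growth_constant_ge0 HF k00) e0.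
have hT := HT _ (lexx T0).
have bc := feasible_budget HF fc.
have /andP[h1 _] := real_utility_bounds HF Hu rho0 alam eps0 bc T00.
have [u_nd _ cu _ _] := Hu.
have cvh : cum (felicity u rho (f_ j)) T0 @[j --> \oo] --> cum (felicity u rho c) T0.
  apply: (@cum_dominated _ _ _ (u (g T0))).
  - move=> n; apply: measurable_funTS; apply: (felicity_measurable Hu).
      by case: (bf n) => -[].
    by move=> t; have /andP[] := fg n t.
  - by apply: measurable_funTS; apply: (felicity_measurable Hu) => //; case: pc.
  - move: cvf; apply: filterS; first exact: (ae_filter_ringOfSetsType mu).
    move=> s H /andP[s0 _]; rewrite /felicity; apply: cvgM; first exact: cvg_cst.
    have -> : (fun j => u (f_ j s)) = (fun j => (fun x => u (Num.max x 0)) (f_ j s)).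
      by apply/funext => j; rewrite max_l//; have /andP[] := fg j s.
    have -> : u (c s) = (fun x => u (Num.max x 0)) (c s).
      by rewrite max_l//; have /andP[] := cg s.
    exact: (cvg_comp _ _ (H s0) (cu (c s))).
  - move=> n s /andP[s0 sT]; have /andP[f0 fgs] := fg n s.
    rewrite ger0_norm ?(felicity_ge0 Hu)//.
    apply: (@le_trans _ _ (u (f_ n s))).
      by rewrite /felicity ler_piMl ?(util_ge0 Hu)// expR_decay_le1// ltW.
    by apply: u_nd => //; apply: (le_trans fgs); exact: g_nd.
have cvV : (fun j : nat => V - j.+1%:R^-1 - e) @ \oo --> V - 0 - e.
  apply: cvgB; last exact: cvg_cst.
  by apply: cvgB; [exact: cvg_cst|exact: cvg_harmonic].
(* Concavity of [u] passes the near-optimality of the tail to [f_ j], and cutting at [T0] loses at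
   most [e], uniformly in [j]. *)
have : V - 0 - e <= cum (felicity u rho c) T0.
  apply: (ler_cvg_to cvV cvh); apply: nearW => j.
  have /andP[_ h2] := real_utility_bounds HF Hu rho0 alam eps0 (bf j) T00.
  have : V - j.+1%:R^-1 <= J (f_ j).
    apply: (hull_real_utility bd _ (hf j)) => n jn; apply: le_trans (Jd n).
    by rewrite lerD2l lerN2 lef_pV2 ?posrE// ler_nat ltnS.
  move=> h3; apply: (@le_trans _ _ (J (f_ j) - e)); first by rewrite lerD2r.
  by rewrite lerBlDr; apply: (le_trans h2); rewrite lerD2l.
lra.
Qed.

End limit.
End existence.

(** * The production and utility functions *)

Import HBNNSimple.

(* The left-hand integrand need not be measurable. *)
Lemma ae_le_integral_ge0 (d : measure_display) (T : measurableType d) (R : realType)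
    (m : {measure set T -> \bar R})
    (D : set T) (f g : T -> \bar R) : measurable D ->
  measurable_fun D g -> (forall x, D x -> (0 <= g x)%E) ->
  {ae m, forall x, D x -> (f x <= g x)%E} ->
  (\int[m]_(x in D) f x <= \int[m]_(x in D) g x)%E.
Proof.
move=> mD mg g0 fg.
have fp0 (x : T) : (0 <= (f^\+ \_ D)%E x)%E by apply: erestrict_ge0.
rewrite integralE; apply: (@le_trans _ _ (\int[m]_(x in D) f^\+ x)%E).
  rewrite -[leRHS]sube0; apply: leeB => //; exact: integral_ge0.
rewrite integral_mkcond [leRHS]integral_mkcond ge0_integralTE//.
apply: ge_ereal_sup => _ [h /= hf <-]; rewrite -integralT_nnsfun.
apply: ae_ge0_le_integral => //.
- by move=> x _; rewrite lee_fin; exact: fun_ge0.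
- by apply/measurable_EFinP; exact: measurable_funPT.
- by move=> x _; apply: erestrict_ge0.
- exact/(measurable_restrictT g).
move: fg; apply: filterS => x H _.
 apply: (le_trans (hf x)); rewrite !patchE; case: ifPn => // xD.
rewrite inE in xD; rewrite funeposE ge_max (g0 x xD) andbT; exact: H.
Qed.

Section primitives.
Context {R : realType}.
Notation mu := (@lebesgue_measure R).
Implicit Types (F f g h c k : R -> R) (t x y : R).

Lemma derivable1_continuous f : (forall x, derivable f x 1) -> continuous f.
Proof. by move=> df x; apply: differentiable_continuous; exact/derivable1_diffP. Qed.

Lemma derivable1_mvt f x y : (forall x, derivable f x 1) -> x < y ->
  exists2 z, x < z < y & f y - f x = derive1 f z * (y - x).
Proof.
move=> df xy.
have [||z] := @MVT _ f (derive1 f) x y xy.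
- by move=> z _; rewrite derive1E; exact/derivableP.
- by apply: continuous_subspaceT; exact: derivable1_continuous.
by rewrite in_itv/= => zxy ->; exists z.
Qed.

(** Beyond some [x0] the derivative is at most [a], so the mean value theorem gives F(x) <= F(x0) +
    a (x - x0); below [x0] monotonicity suffices. Hence [b] is F(x0) / a. *)
Lemma production_growth F (L klow kbar a : R) : production_function F L klow kbar ->
  L < a -> exists b, growth_bound F a b.
Proof.
move=> hF La.
have dF := prod_derivable hF; have dF0 := prod_derive_gt0 hF.
have F0 := prod_at0 hF; have L0 := prod_limit_gt0 hF.
have Fnd x y : x <= y -> F x <= F y.
  rewrite le_eqVlt => /orP[/eqP->//|xy].
  have [z _ E] := derivable1_mvt dF xy.
  by rewrite -subr_ge0 E mulr_ge0 ?subr_ge0 ?(ltW xy) ?(ltW (dF0 z)).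
have aL : 0 < a - L by rewrite subr_gt0.
have /cvgrPdist_lt/(_ _ aL)[A [_ HA]] := prod_derive_cvg hF.
pose x0 := `|A| + 1.
have x00 : 0 < x0 by rewrite ltr_wpDl.
have dFa z : x0 <= z -> derive1 F z <= a.
  move=> xz; have : A < z.
    by apply: (le_lt_trans (ler_norm A)); apply: lt_le_trans xz; rewrite ltrDl.
  by move=> /HA; rewrite ltr_norml => /andP[h _]; lra.
have a0 : 0 < a by exact: lt_trans La.
have Fx0 : 0 <= F x0 by rewrite -F0; apply: Fnd; exact: ltW.
exists (F x0 / a); split => //.
- exact: derivable1_continuous.
- by split => //; rewrite divr_ge0// ltW.
move=> x x_ge0; rewrite mulrDr (mulrC a (_ / _)) divfK ?gt_eqF//.
have ax : 0 <= a * x by rewrite mulr_ge0// ltW.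
have [xx0|xx0] := leP x x0; first by have := Fnd _ _ xx0; lra.
have [z /andP[z1 z2] E] := derivable1_mvt dF xx0.
have : derive1 F z * (x - x0) <= a * (x - x0).
  by rewrite ler_wpM2r ?subr_ge0 ?(ltW xx0)// dFa// ltW.
have : 0 <= a * x0 by rewrite mulr_ge0// ltW.
lra.
Qed.

Section utility.
Variables (u : R -> R) (rho L eps : R).
Hypothesis hu : utility_function u rho L eps.
Hypothesis rho0 : 0 < rho.
Hypothesis eps0 : 0 < eps.
Hypothesis L0 : 0 < L.

(** If [u x] exceeded the tangent by [e * |x - y|], concavity would keep the excess at least
    proportional on the segment towards [y], against an error below [e * |h|] in the derivative at
    [y]. *)
Lemma util_supergradient x y : 0 < y -> 0 <= x -> u x <= u y + derive1 u y * (x - y).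
Proof.
move=> y0 x0; have [->|xy] := eqVneq x y; first by rewrite subrr mulr0 addr0.
rewrite leNgt; apply/negP => H.
have n0 : 0 < `|x - y| by rewrite normr_gt0 subr_eq0.
pose e := (u x - u y - derive1 u y * (x - y)) / `|x - y|.
have e0 : 0 < e by rewrite divr_gt0//; lra.
have du := util_derivable hu y0.
have : h^-1 *: (u (h *: 1 + y) - u y) @[h --> 0^'] --> derive1 u y.
  by rewrite derive1E; exact: du.
move=> /cvgrPdist_lt/(_ _ e0)/nbhs_ballP[del /= del0 Hdel].
pose s := Num.min (1/2) (del / (2 * `|x - y|)).
have s0 : 0 < s by rewrite lt_min divr_gt0// divr_gt0 ?mulr_gt0.
have s1 : s < 1 by rewrite gt_min; apply/orP; left; lra.
have sd : s * `|x - y| < del.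
  apply: (@le_lt_trans _ _ (del / (2 * `|x - y|) * `|x - y|)).
    by rewrite ler_wpM2r// ge_min lexx orbT.
  rewrite (_ : _ * _ = del / 2); first by lra.
  by field; rewrite gt_eqF.
pose h := s * (x - y).
have hn0 : h != 0 by rewrite mulf_neq0 ?subr_eq0 ?(gt_eqF s0).
have := Hdel h; rewrite /ball/= sub0r normrN normrM (ger0_norm (ltW s0)).
move=> /(_ sd hn0); rewrite /GRing.scale/= mulr1 => q.
have sc : s * u x + (1 - s) * u y < u (s * x + (1 - s) * y).
  by apply: (util_strictly_concave hu); rewrite /= ?in_itv/= ?andbT ?s0 ?s1// ltW.
have hE : h + y = s * x + (1 - s) * y by rewrite /h; ring.
rewrite hE in q; set D := u (s * x + (1 - s) * y) - u y in q.
have D1 : s * (u x - u y) < D by rewrite /D; lra.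
have q2 : `|derive1 u y * h - D| < e * `|h|.
  rewrite (_ : derive1 u y * h - D = (derive1 u y - h^-1 * D) * h); last first.
    by rewrite mulrBl mulrAC mulVf// mul1r.
  by rewrite normrM ltr_pM2r// normr_gt0.
have : e * `|h| = s * (u x - u y - derive1 u y * (x - y)).
  by rewrite /e /h normrM (ger0_norm (ltW s0)); field; rewrite gt_eqF.
move=> q3; move: q2; rewrite q3 ltr_norml => /andP[q4 _].
have : derive1 u y * h = s * (derive1 u y * (x - y)) by rewrite /h; ring.
lra.
Qed.

Lemma util_nd x y : 0 <= x -> x <= y -> u x <= u y.
Proof.
move=> x0; rewrite le_eqVlt => /orP[/eqP->//|xy].
by apply: ltW; exact: (util_increasing hu).
Qed.

Lemma util_extension_continuous : continuous (fun x => u (Num.max x 0)).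
Proof.
move=> x; apply/cvgrPdist_lt => e e0.
have mx : `[0, +oo[%classic (Num.max x 0) by rewrite /= in_itv/= andbT le_max lexx orbT.
have := (subspace_continuousP _ _).1 (util_continuous hu) _ mx.
move=> /cvgrPdist_lt/(_ _ e0); rewrite near_withinE => /nbhs_ballP[del /= del0 Hdel].
apply/nbhs_ballP; exists del => //= z xz.
apply: Hdel; last by rewrite /= in_itv/= andbT le_max lexx orbT.
rewrite /ball/=; apply: le_lt_trans xz.
case: (leP x 0) => x0; case: (leP z 0) => z0; rewrite ?subrr ?normr0//.
- rewrite sub0r normrN distrC !ger0_norm; lra.
- rewrite subr0 !ger0_norm; lra.
Qed.

Lemma utility_is_bounded : exists M, utility_bounds u (derive1 u) rho (L + eps) eps M.
Proof.
have u0 := util_at0 hu.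
have u_ge0 x : 0 <= x -> 0 <= u x by move=> x0; rewrite -u0; exact: util_nd.
have /cvgrPdist_lt/(_ _ ltr01)[A [_ HA]] := util_discount hu.
pose T := `|A| + 1; have T0 : 0 < T by rewrite ltr_wpDl.
have lam0 : 0 <= L + eps by rewrite addr_ge0// ltW.
(* Beyond [T] the discounted expression is below 1 since it tends to 0; on [0, T] monotonicity
   bounds its increasing factors by their values at [T]. *)
exists (expR (eps * T) * u (expR ((L + eps) * T)) + 1); split => //.
- exact: util_nd.
- exact: util_extension_continuous.
- move=> y y0; split; last by move=> x; exact: util_supergradient.
  (* Positivity of the derivative: u(y) < u(y + 1) <= u(y) + u'(y). *)
  have y1 : 0 <= y + 1 by lra.
  have := util_supergradient y0 y1.
  have : u y < u (y + 1) by apply: (util_increasing hu); lra.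
  rewrite (_ : y + 1 - y = 1); last by ring.
  rewrite mulr1; lra.
move=> t t0; have ue s : 0 <= u (expR s) by apply: u_ge0; exact: expR_ge0.
have [tT|tT] := leP t T; last first.
  have At : A < t.
    by apply: (le_lt_trans (ler_norm A)); apply: lt_trans tT; rewrite ltrDl.
  have := HA _ At; rewrite sub0r normrN => h.
  apply: (le_trans (ler_norm _)); apply: (le_trans (ltW h)).
  by rewrite lerDr mulr_ge0 ?expR_ge0.
rewrite -[leLHS]addr0; apply: lerD => //.
apply: ler_pM; rewrite ?mulr_ge0 ?expR_ge0//.
  rewrite -[leRHS]mulr1; apply: ler_pM; rewrite ?expR_ge0 ?expR_decay_le1 ?(ltW rho0)//.
  by rewrite ler_expR ler_pM2l.
by apply: util_nd; rewrite ?expR_ge0// ler_expR ler_wpM2l.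
Qed.

Lemma util_derive_small e : 0 < e ->
  exists2 N0, 0 < N0 & forall N, N0 <= N -> derive1 u N <= e.
Proof.
move=> e0; have /cvgrPdist_lt/(_ _ e0)[A [_ HA]] := util_derive_at_pinfty hu.
exists (`|A| + 1); first by rewrite ltr_wpDl.
move=> N AN; have : A < N.
  by apply: (le_lt_trans (ler_norm A)); apply: lt_le_trans AN; rewrite ltrDl.
move=> /HA; rewrite sub0r normrN => h.
by apply: (le_trans (ler_norm _)); exact: ltW.
Qed.

End utility.

Lemma ae_eq_cum f g : L1_loc f -> L1_loc g ->
  {ae mu, forall t : R, 0 <= t -> f t = g t} -> forall t, cum f t = cum g t.
Proof.
move=> lf lg fg t; rewrite /cum /Rintegral; congr fine.
apply: ae_eq_integral => //.
- by have /integrableP[] := L1_loc_int t lf.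
- by have /integrableP[] := L1_loc_int t lg.
move: fg; apply: filterS; first exact: (ae_filter_ringOfSetsType mu).
by move=> s H /=; rewrite in_itv/= => /andP[/H-> _].
Qed.

(** The positive part of [c], extended by 0 to negative times, has the same running integral, so the
    trajectory of [c] is a subsolution for it. *)
Lemma admissible_normalize F (a b k0 : R) c : growth_bound F a b -> 0 <= k0 ->
  admissible F k0 c -> exists2 c', feasible F k0 c' &
    {ae mu, forall t : R, 0 <= t -> c t = c' t}.
Proof.
move=> HF k00 [lc c0 [k [trk k_ge0]]].
have [cF ndF F0 _ _] := HF.
pose c' := (fun t => Num.max (c t) 0) \_ `[0, +oo[.
have cc' : {ae mu, forall t : R, 0 <= t -> c t = c' t}.
  move: c0; apply: filterS; first exact: (ae_filter_ringOfSetsType mu).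
  move=> t H t0; rewrite /c' patchE mem_set/= ?in_itv/= ?t0//.
  by rewrite max_l// H.
have mc' : measurable_fun setT c'.
  apply/(measurable_restrictT (fun t => Num.max (c t) 0)) => //.
  by apply: measurable_maxr; [exact: L1_loc_measurable|exact: measurable_cst].
have c'0 t : 0 <= c' t by rewrite /c' patchE; case: ifP => // _; rewrite le_max lexx orbT.
have lnc : L1_loc (fun t => `|c t|).
  by move=> T T0; exact: (integrable_norm (lc T T0)).
have lc' : L1_loc c'.
  apply: (L1_loc_le mc' _ lnc) => t _; rewrite ger0_norm//.
  rewrite /c' patchE; case: ifP => _; last exact: normr_ge0.
  by rewrite ge_max ler_norm normr_ge0.
have [lFk Hk] := trajectory_integral cF lc trk.
have E t : cum c t = cum c' t by exact: ae_eq_cum.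
exists c' => //; split => //; exists (k \_ `[0, +oo[).
have kE t : 0 <= t -> (k \_ `[0, +oo[) t = k t.
  by move=> t0; rewrite patchE mem_set//= in_itv/= t0.
have lk : L1_loc k.
  apply: L1_loc_continuous => T T0; apply: ac_continuous.
  by case: trk => _ + _; exact.
have Fk0 s : 0 <= s -> 0 <= (F \o k) s.
  by move=> s0; rewrite -F0; apply: ndF; exact: k_ge0.
split.
- apply/(measurable_restrictT k) => //; exact: L1_loc_measurable.
- by move=> t t0; rewrite kE//; exact: k_ge0.
- move=> T; exists (k0 + cum (F \o k) T) => t /andP[t0 tT]; rewrite kE// Hk// E.
  have : cum (F \o k) t <= cum (F \o k) T by exact: cum_nd.
  have : 0 <= cum c' t by exact: cum_ge0.
  lra.
- move=> t t0; rewrite kE// Hk// E (@eq_cum _ (F \o k) (F \o k \_ `[0, +oo[))//.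
  by move=> s /andP[s0 _] /=; rewrite kE.
Qed.

Lemma bounded_Linfty_loc f g : measurable_fun setT f ->
  (forall t, 0 <= f t <= g t) -> {homo g : s t / s <= t} -> Linfty_loc f.
Proof.
move=> mf fg g_nd T T0; split; first exact: measurable_funTS.
have B0 : 0 <= g T by have /andP[h1 h2] := fg T; exact: le_trans h2.
rewrite /finite_norm unlock; case: ifP => _; last exact: ltry.
apply: (@le_lt_trans _ _ (g T)%:E); last exact: ltry.
apply/ess_supP/aeW => t; rewrite /= lee_fin patchE; case: ifPn => [|_]; last by rewrite normr0.
rewrite inE/= in_itv/= => /andP[_ tT]; have /andP[f0 ft] := fg t.
by rewrite ger0_norm// (le_trans ft)// g_nd.
Qed.

End primitives.

Theorem mainTheorem1 (R : realType) (F u : R -> R)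
    (L klow kbar rho eps0 : R)
    (hF : production_function F L klow kbar)
    (hrho : 0 < rho) (heps0 : 0 < eps0)
    (hu : utility_function u rho L eps0)
    (k0 : R) (hk0 : 0 <= k0) :
  exists cstar : R -> R,
    [/\ admissible F k0 cstar,
        total_utility u rho cstar = value_function F u rho k0,
        value_function F u rho k0 \is a fin_num,
        (forall t : R, 0 <= t -> 0 <= cstar t) &
        Linfty_loc cstar].
Proof.
have L0 := prod_limit_gt0 hF.
(* Any growth rate strictly between [L] and [L + eps0] would serve. *)
have La : L < L + eps0 / 2 by rewrite ltrDl divr_gt0.
have alam : L + eps0 / 2 < L + eps0 by lra.
have [b HF] := production_growth hF La.
have [M Hu] := utility_is_bounded hu hrho heps0 L0.
have Hp := util_derive_small hu.
have [g [c [g_nd fc cg Jc]]] := exists_optimal HF hk0 Hu Hp hrho alam heps0.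
have a0 : 0 < L + eps0 / 2 by exact: lt_trans La.
have totE c' : feasible F k0 c' -> total_utility u rho c' = (real_utility u rho c')%:E.
  move=> /(feasible_budget HF) bc.
  by have [] := total_utilityE Hu hrho a0 alam heps0 bc.
have [[mc c0 lc] [k sk]] := fc.
have adm : admissible F k0 c by exact: (subsolution_admissible HF lc (fun t _ => c0 t) hk0 sk).
have VE : value_function F u rho k0 = total_utility u rho c.
  apply/eqP; rewrite eq_le; apply/andP; split; last by apply: ereal_sup_ubound; exists c.
  apply: ge_ereal_sup => _ [c1 ac1 <-].
  have [c2 fc2 c12] := admissible_normalize HF hk0 ac1.
  have [[mc2 c20 _] _] := fc2.
  (* [c1] may be negative on a null set, where [u] is arbitrary, so its integrand is not known to be
     measurable; an inequality of integrals is enough. *)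
  apply: (@le_trans _ _ (total_utility u rho c2)).
    apply: ae_le_integral_ge0 => //.
    - apply/measurable_EFinP; apply: measurable_funTS.
      exact: (felicity_measurable Hu).
    - by move=> t _; rewrite lee_fin; exact: (felicity_ge0 Hu).
    - move: c12; apply: filterS; first exact: (ae_filter_ringOfSetsType lebesgue_measure).
      by move=> t H; rewrite /= in_itv/= andbT => /H ->.
  rewrite !totE// lee_fin; apply: le_trans Jc.
  exact: (real_utility_le_value HF Hu hrho alam heps0 hk0 fc2).
exists c; split => //.
- by rewrite VE totE.
- exact: bounded_Linfty_loc mc cg g_nd.
Qed.
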